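(* Let $k>d\ge2$ be integers and let $\epsilon>0$. For Lebesgue almost all linear maps $L:\mathbb{R}^d\to\mathbb{R}^{k-d}$ the following holds for the corresponding cubical cut and project sets. Let $F_\pi$ be an admissible internal space (with projection $\pi$), let $s\in\mathbb{R}^k$ be regular, $Y=Y_s$, and let $\mathcal{P}$ be an equivalence class of patches of $Y$ of type I or type II. Then there is a constant $C>0$, depending only on $E$, $\epsilon$, $\mathcal{P}$ and $\pi$, such that for every $y\in Y$ and every bounded set $A\subseteq E$ with $X_A\neq\emptyset$, \[ |\xi_{\mathcal P}(y,A)-\xi_{\mathcal P}|\le C\,\frac{|\partial H|}{\#X_A}, \] where $H=\bigcup_{n\in X_A}([-1/2,1/2]^d+n)\subset\mathbb{R}^d$ is the cube-complex covering $X_A$ and $|\partial H|$ is the $(d-1)$-dimensional Hausdorff measure of its boundary. In the case of type II patches, $C$ can be taken independent of $\mathcal{P}$.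
   Context: Cut and project setting. Let $0<d<k$ be integers. A linear map $L:\mathbb{R}^d\to\mathbb{R}^{k-d}$ is identified with its matrix $(\alpha_{ij})\in\mathbb{R}^{d(k-d)}$, $L(x)_i=\sum_{j=1}^d\alpha_{ij}x_j$, and ''almost all $L$'' refers to Lebesgue measure on $\mathbb{R}^{d(k-d)}$. The physical space is $E=\{(x,L(x)) : x\in\mathbb{R}^d\}\subset\mathbb{R}^k$. Standing assumption: $E$ is totally irrational, i.e. $E+\mathbb{Z}^k$ is dense in $\mathbb{R}^k$. An admissible internal space is a linear subspace $F_\pi\subset\mathbb{R}^k$ complementary to $E$ such that the projection $\pi:\mathbb{R}^k\to E$ along $F_\pi$ is injective on $\mathbb{Z}^k$; $\pi^*$ denotes the projection onto $F_\pi$ along $E$. The reference space is $F_\rho=\{0\}^d\times\mathbb{R}^{k-d}$, and $\rho:\mathbb{R}^k\to E$ is the projection onto $E$ along $F_\rho$. The cubical window is $\mathcal{W}_\pi=\pi^*(\{0\}^d\times[0,1]^{k-d})$ and the slice is $\mathcal{S}=\mathcal{W}_\pi+E$. For $s\in\mathbb{R}^k$ the cubical cut and project set is $Y_s=\pi(\mathcal{S}\cap(\mathbb{Z}^k+s))$. The point $s$ (and $Y_s$) is regular if $\partial\mathcal{S}\cap(\mathbb{Z}^k+s)=\emptyset$. For $y\in Y=Y_s$, $\tilde y$ denotes the unique element of $\mathbb{Z}^k+s$ with $\pi(\tilde y)=y$. Patches of type I and II. Let $\Omega\subseteq E$ be a bounded convex set containing a neighbourhood of the origin of $E$, and $r>0$.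 For $y\in Y$, \[ P_{\mathrm I}(y,r\Omega)=\{y'\in Y : y'-y\in r\Omega\},\qquad P_{\mathrm{II}}(y,r\Omega)=\{y'\in Y : \tilde y'-\tilde y\in\rho^{-1}(r\Omega)\}. \] For each type $*\in\{\mathrm I,\mathrm{II}\}$, two patches $P_*(y_1,r\Omega)$ and $P_*(y_2,r\Omega)$ are equivalent if $P_*(y_1,r\Omega)-y_1=P_*(y_2,r\Omega)-y_2$, and $\mathcal{P}_*(y,r\Omega)$ denotes the equivalence class of $P_*(y,r\Omega)$. An equivalence class $\mathcal P$ is understood to come with its type $*$, $r$ and $\Omega$. Frequencies. With $C(R)=\mathbb{Z}^k\cap([-R,R]^d\times\mathbb{R}^{k-d})$, the frequency of $\mathcal P$ is \[ \xi_{\mathcal P}=\lim_{R\to\infty}\frac{\#\{y'\in Y : \mathcal{P}_*(y',r\Omega)=\mathcal{P},\ \tilde y'-\tilde y\in C(R)\}}{\#\{y'\in Y : \tilde y'-\tilde y\in C(R)\}} \] (this limit exists and does not depend on $s$ or $y\in Y$). For a search region $A\subseteq E$ (bounded), \[ \xi_{\mathcal P}(y,A)=\frac{\#\{y'\in Y : \mathcal{P}_*(y',r\Omega)=\mathcal{P},\ \tilde y'-\tilde y\in A+F_\rho\}}{\#\{y'\in Y : \tilde y'-\tilde y\in A+F_\rho\}}. \] $A_d\subset\mathbb{R}^d$ is the image of $A$ under the projection of $\mathbb{R}^k$ to its first $d$ coordinates, and $X_A=\mathbb{Z}^d\cap A_d$ (the denominator of $\xi_{\mathcal P}(y,A)$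 equals $\#X_A$). *)

(* Defs.v *)
From HB Require Import structures.
From mathcomp Require Import all_boot all_order all_algebra finmap.
From mathcomp Require Import all_classical all_reals all_analysis.

Set Implicit Arguments.
Unset Strict Implicit.
Unset Printing Implicit Defensive.

Import Order.TTheory GRing.Theory Num.Theory.
Import numFieldNormedType.Exports.

Local Open Scope classical_set_scope.
Local Open Scope ring_scope.

(* Junk value 0 on infinite sets; it is only applied to finite ones. *)
Definition ncard (T : choiceType) (A : set T) : nat := #|` fset_set A|.

Definition boundary (T : topologicalType) (A : set T) : set T :=
  closure A `\` A°.

Section LebesgueNull.
Context {R : realType} {m n : nat}.

(* Lebesgue outer measure on R^(m * n) = 'M[R]_(m, n): coverings by countably
   many closed boxes. *)
Definition lebesgue_outer (N : set 'M[R]_(m, n)) : \bar R :=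
  ereal_inf [set (\sum_(0 <= t <oo)
                    (\prod_i \prod_j (ab.2 t i j - ab.1 t i j))%:E)%E
            | ab in [set ab : (nat -> 'M[R]_(m, n)) * (nat -> 'M[R]_(m, n)) |
                (forall t i j, ab.1 t i j <= ab.2 t i j) /\
                N `<=` \bigcup_t
                  [set M : 'M[R]_(m, n) |
                    forall i j, ab.1 t i j <= M i j <= ab.2 t i j]]].

Definition almost_all (P : set 'M[R]_(m, n)) : Prop :=
  lebesgue_outer (~` P) = 0%E.

End LebesgueNull.

Section Hausdorff.
Context {R : realType} {n : nat}.

(* The norm `|_| provided by the library on matrices is the sup norm. *)
Definition euclid_norm (v : 'cV[R]_n) : R := Num.sqrt (\sum_i v i 0 ^+ 2).

(* Real supremum: only meaningful on bounded sets; it is 0 on the empty set. *)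
Definition diam (U : set 'cV[R]_n) : R :=
  sup [set euclid_norm (x - y) | x in U & y in U].

(* Volume of the Euclidean unit ball of R^p. *)
Fixpoint ball_volume (p : nat) : R :=
  match p with
  | 0 => 1
  | 1 => 2
  | (q.+1).+1 => 2 * pi / (q.+2)%:R * ball_volume q
  end.

Definition hausdorff_pre (p : nat) (delta : R) (A : set 'cV[R]_n) : \bar R :=
  ereal_inf [set (\sum_(0 <= t <oo) (diam (U t) ^+ p)%:E)%E
            | U in [set U : nat -> set 'cV[R]_n |
                (forall t x y, U t x -> U t y ->
                   euclid_norm (x - y) <= delta) /\
                A `<=` \bigcup_t U t]].

(* p-dimensional Hausdorff measure, normalised so as to agree with Lebesgue
   measure on R^p; for p > 0 only, since empty sets contribute 0 ^+ 0 = 1 to the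
   above sum when p = 0. *)
Definition hausdorff (p : nat) (A : set 'cV[R]_n) : \bar R :=
  ((ball_volume p / 2 ^+ p)%:E *
   ereal_sup [set hausdorff_pre p delta A |
                delta in [set t : R | (0 < t)%R]])%E.

End Hausdorff.

Definition integer_points (R : realType) (n : nat) : set 'cV[R]_n :=
  [set v : 'cV[R]_n | forall i, v i 0 \is a Num.int].
Arguments integer_points {R n}.

Inductive patch_type := TypeI | TypeII.

(* An equivalence class of patches P_*(y, r Omega) is recorded by its type, r,
   Omega, and the common value of P_*(y, r Omega) - y. *)
Record patch_class (R : realType) (d m : nat) := PatchClass {
  class_type : patch_type;
  class_radius : R;
  class_region : set 'cV[R]_(d + m);
  class_shape : set 'cV[R]_(d + m) }.

(* R^k is 'cV[R]_(d + m), with m = k - d. *)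
Section CutAndProject.
Context {R : realType} {d m : nat}.
Local Notation V := 'cV[R]_(d + m).
Variable L : 'M[R]_(m, d).

(* { (x, L x) : x in R^d } *)
Definition phys : {vspace V} := limg (linfun (mulmx (col_mx 1%:M L))).

(* {0}^d x R^m *)
Definition Frho : {vspace V} := limg (linfun (mulmx (col_mx 0 1%:M))).

Definition totally_irrational : Prop :=
  dense [set e + z | e in [set` phys] & z in integer_points].

Definition rho : V -> V := daddv_pi phys Frho.

Section InternalSpace.
Variable F : {vspace V}.

Definition projE : V -> V := daddv_pi phys F.
Definition projF : V -> V := daddv_pi F phys.

Definition admissible : Prop :=
  [/\ (phys :&: F = 0)%VS, (phys + F = fullv)%VS
    & {in integer_points &, injective projE}].

Definition window : set V :=
  projF @` [set v : V | usubmx v = 0 /\ forall i, 0 <= dsubmx v i 0 <= 1].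

Definition slice : set V := [set w + e | w in window & e in [set` phys]].

Section Translate.
Variable s : V.

Definition lattice : set V := [set z + s | z in integer_points].

Definition regular_point : Prop := boundary slice `&` lattice = set0.

Definition cps : set V := projE @` (slice `&` lattice).

(* The element of Z^k + s that projE maps to y. *)
Definition tilde (y : V) : V := xget 0 [set z | lattice z /\ projE z = y].

Definition cps_patch (ty : patch_type) (r : R) (Om : set V) (y : V) : set V :=
  [set y' | cps y' /\
     match ty with
     | TypeI => [set r *: v | v in Om] (y' - y)
     | TypeII => [set r *: v | v in Om] (rho (tilde y' - tilde y))
     end].

Definition class_of (ty : patch_type) (r : R) (Om : set V) (y : V) :
    patch_class R d m :=
  PatchClass ty r Om [set y' - y | y' in cps_patch ty r Om y].

Definition patch_region (Om : set V) : Prop :=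
  [/\ Om `<=` [set` phys], bounded_set Om,
      convex_set (Om : set (convex_lmodType V))
    & \forall v \near (0 : V), v \in phys -> Om v].

Section Frequency.
Variable P : patch_class R d m.

Definition has_class (y : V) : Prop :=
  class_of (class_type P) (class_radius P) (class_region P) y = P.

Definition is_patch_class : Prop :=
  [/\ 0 < class_radius P, patch_region (class_region P)
    & exists2 y, cps y & has_class y].

(* The proportion of points of class P among the y' of Y such that
   tilde y' - tilde y is in D. *)
Definition proportion (y : V) (D : set V) : R :=
  (ncard [set y' | [/\ cps y', has_class y' & D (tilde y' - tilde y)]])%:R /
  (ncard [set y' | cps y' /\ D (tilde y' - tilde y)])%:R.

Definition slab (t : R) : set V :=
  integer_points `&` [set v : V | forall i, - t <= usubmx v i 0 <= t].

Definition frequency (y : V) : R :=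
  lim (proportion y (slab t) @[t --> +oo]).

Definition local_frequency (y : V) (A : set V) : R :=
  proportion y [set a + f | a in A & f in [set` Frho]].

End Frequency.
End Translate.
End InternalSpace.

Definition search_points (A : set V) : set 'cV[R]_d :=
  integer_points `&` (@usubmx R d m 1 @` A).

Definition cube_complex (X : set 'cV[R]_d) : set 'cV[R]_d :=
  \bigcup_(n in X)
    [set u + n | u in [set u : 'cV[R]_d |
                        forall i, - 2^-1 <= u i 0 <= 2^-1]].

(* The frequency of P is computed from the base point y0; y0 is universally
   quantified because it does not depend on it. *)
Definition frequency_bound (F : {vspace V}) (P : patch_class R d m) (C : R) :
    Prop :=
  forall s, regular_point F s -> is_patch_class F s P ->
  forall y0 y, cps F s y0 -> cps F s y ->
  forall A : set V, A `<=` [set` phys] -> bounded_set A ->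
  search_points A !=set0 ->
  (`|local_frequency F s P y A - frequency F s P y0|%:E <=
   C%:E * hausdorff d.-1 (boundary (cube_complex (search_points A))) *
   ((ncard (search_points A))%:R^-1)%:E)%E.

End CutAndProject.

(* Main.v *)
(** Modulo [E] the slice is a unit cube and [Z^k + s] is an orbit
    [n |-> x_n = t - L n] of [Z^d] on the torus [R^(k-d) / Z^(k-d)].  A patch
    class is seen at [n] exactly when [x_n] lies in a fixed boolean combination
    of boxes; for type II this combination is a single box, which is why the
    constant does not depend on the class.  The theorem has two ingredients.

    - For almost all [L] the discrepancy of a cube of side [N = 2^i] in [Z^d] is
      [O((3/2)^i)], uniformly in the box and in the base point.  After rounding
      [L] to a matrix [A] over [F_q], with [q] a prime of size a power of [N],
      a Fourier expansion bounds the discrepancy by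
      [sum_(h <> 0) prod_i w(h_i) / q * prod_j w((h A)_j)] with
      [w(a) = q / min(a, q - a)].  For fixed [h <> 0] the vector [h A] is
      uniformly distributed when [A] is, so the mean of this bound over [A] is
      polylogarithmic in [q], and Borel-Cantelli applies.

    - Let [f] have sums [O(C_i)] over all cubes of side [2^i] in [Z^d], with
      [C_i 2^(i (1 - d))] summable.  Comparing the averages [M_i f] of [f] over
      such cubes, [M_(i+1) f] is a mean of translates of [M_i f] by vectors of
      size [2^i], and translating [X] by such a vector changes [O(2^i |bd H|)]
      of its points.  Hence the sum of [f] over [X] is
      [O(sum_i C_i 2^(-i d) 2^i |bd H|) = O(|bd H|)]. *)

Require Import Defs.
From mathcomp Require Import all_boot all_order all_algebra.
From mathcomp Require Import finmap ring lra zify.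
From mathcomp.real_closed Require Import complex.
From mathcomp Require Import all_classical all_reals all_analysis.

Set Implicit Arguments.
Unset Strict Implicit.
Unset Printing Implicit Defensive.

Import Order.TTheory GRing.Theory Num.Theory.
Import numFieldNormedType.Exports.

(** * A prime between 2^r and 2^(2r+4) *)

(** The modulus has to meet two opposite demands. Replacing [L] by [A / q] moves the orbit by up to
    [d N / q] over a cube of side [N], so [q >= N^(d+1)] makes rounding cost only O(1) among the
    [N^d] points; and [log q] must stay O(log N), so that [(3/2)^i] beats the polylogarithmic mean.
    A crude form of Bertrand's postulate serves both. Primality makes [F_q] a field, which is what
    makes [h A] uniform for every nonzero [h]. On the physical side [|bd H|] is compared with a
    combinatorial quantity, the number of points of [X] that leave [X] under a unit step. Each of
    them exposes a face of the cube complex, and only a lower bound for the Hausdorff measure is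
    required. Regularity of [s] keeps every [x_n] inside the open cube, so that each [n] carries
    exactly one point of [Y]. *)

(** By Legendre's formula the exponent of [p] is the sum over [i] of
    [floor(2n / p^i) - 2 floor(n / p^i)]; each term is 0 or 1 and vanishes once [p^i > 2n]. *)
Lemma logn_central_binomial (p n : nat) :
  prime p -> (0 < n)%N -> (p ^ logn p 'C(n + n, n) <= n + n)%N.
Proof.
move=> p_pr n_gt0; set B := 'C(n + n, n).
have B_gt0 : (0 < B)%N by rewrite bin_gt0 leq_addr.
have p_gt1 := prime_gt1 p_pr.
have key : (logn p B + (logn p n`! + logn p n`!) = logn p (n + n)`!)%N.
  rewrite -!lognM ?muln_gt0 ?fact_gt0 // -(@bin_fact (n + n) n) ?leq_addr //.
  by rewrite addnK.
pose s := \sum_(1 <= i < (n + n).+1) (p ^ i <= n + n)%N.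
have ext : logn p n`! = \sum_(1 <= i < (n + n).+1) n %/ p ^ i.
  rewrite logn_fact // [RHS](big_cat_nat (n := n.+1)) //=; last by lia.
  rewrite -[LHS]addn0; congr (_ + _)%N; apply/esym/big1_seq => i /=.
  rewrite mem_index_iota => /andP[ni _].
  by apply: divn_small; apply: ltn_trans ni (ltn_expl i p_gt1).
have les : (logn p B <= s)%N.
  suff : (logn p (n + n)`! <= s + (logn p n`! + logn p n`!))%N by lia.
  rewrite logn_fact // ext -!big_split /=; apply: leq_sum => i _.
  have q_gt0 : (0 < p ^ i)%N by rewrite expn_gt0 (ltnW p_gt1).
  have [h|h] := leqP (p ^ i) (n + n); last by rewrite divn_small.
  by rewrite divnD // addnC leq_add2r leq_b1.
have sle (t : nat) :
    (\sum_(1 <= i < t.+1) (p ^ i <= n + n)%N <= trunc_log p (n + n))%N.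
  elim: t => [|t IH]; first by rewrite big_geq.
  rewrite big_nat_recr //=.
  have [h|h] := leqP (p ^ t.+1) (n + n); last by rewrite addn0.
  apply: leq_trans (trunc_log_max p_gt1 h); rewrite addn1 ltnS.
  apply: (@leq_trans (\sum_(1 <= i < t.+1) 1)%N).
    by apply: leq_sum => i _; apply: leq_b1.
  by rewrite sum_nat_const_nat muln1 subn1.
apply: (@leq_trans (p ^ trunc_log p (n + n))); last by rewrite trunc_logP //; lia.
by rewrite leq_exp2l // (leq_trans les (sle _)).
Qed.

Lemma exp2_le_central_binomial n : (2 ^ n <= 'C(n + n, n))%N.
Proof.
elim: n => // n IH.
have h1 : ('C(n + n, n) <= 'C((n + n).+1, n))%N by apply: leq_bin2l.
have h2 : ('C(n + n, n) <= 'C((n + n).+1, n.+1))%N.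
  by rewrite binS; lia.
rewrite expnS addSn addnS binS; lia.
Qed.

(* Otherwise the central binomial coefficient [C(2n, n)], with [2n = 2^(2r+4)], is a
   product of at most [2^r] prime powers, each of them at most [2n]. *)
Lemma exists_prime_between (r : nat) :
  exists p, [/\ prime p, (2 ^ r < p)%N & (p <= 2 ^ (r.*2 + 4))%N].
Proof.
set n := (2 ^ (r.*2 + 3))%N.
have n_gt0 : (0 < n)%N by rewrite expn_gt0.
have nn : (n + n = 2 ^ (r.*2 + 4))%N.
  by rewrite addnn -mul2n -expnS; congr (2 ^ _)%N; lia.
have [/existsP[p /andP[pp rp]]|] :=
  boolP [exists p : 'I_(n + n).+1, prime p && (2 ^ r < p)%N].
  by exists p; split=> //; rewrite -nn -ltnS.
rewrite negb_exists => /forallP no; exfalso.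
set B := 'C(n + n, n).
have B_gt0 : (0 < B)%N by rewrite bin_gt0 leq_addr.
have Bprod : (B = \prod_(p <- primes B) p ^ logn p B)%N.
  rewrite {1}(prod_prime_decomp B_gt0) prime_decompE big_map /=.
  by apply: eq_big_seq => p _.
have pB p : p \in primes B -> (p <= n + n)%N.
  rewrite mem_primes => /and3P[p_pr _ pB].
  have := @logn_central_binomial p n p_pr n_gt0; apply: leq_trans.
  rewrite -{1}(expn1 p) leq_exp2l ?prime_gt1 //.
  by rewrite -pfactor_dvdn // expn1.
have sz : (size (primes B) <= 2 ^ r)%N.
  rewrite -[leqRHS](size_iota 1 (2 ^ r)); apply: uniq_leq_size; first exact: primes_uniq.
  move=> p pin; rewrite mem_iota add1n ltnS; have ple := pB p pin.
  move: pin; rewrite mem_primes => /and3P[p_pr _ _].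
  have := no (Ordinal (n:=(n + n).+1) (m:=p) ple).
  by rewrite /= p_pr /= -leqNgt prime_gt0.
have : (2 ^ n <= (n + n) ^ (2 ^ r))%N.
  apply: leq_trans (exp2_le_central_binomial n) _; rewrite -/B Bprod.
  apply: (@leq_trans (\prod_(p <- primes B) (n + n))%N).
    rewrite big_seq [leqRHS]big_seq; apply: leq_prod => p.
    by rewrite mem_primes => /and3P[p_pr _ _]; apply: logn_central_binomial.
  by rewrite big_const_seq count_predT iter_muln_1 leq_exp2l //; lia.
(* The exponents now read [2^(2r+3) <= (2r+4) 2^r]; cancelling [2^r] leaves [2^(r+3) <= 2r+4], false
   for every [r]. *)
rewrite nn -expnM leq_exp2l // /n.
have -> : (r.*2 + 3 = (r + 3) + r)%N by lia.
rewrite expnD leq_mul2r expn_eq0 /= leqNgt => /negP; apply.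
elim: r {n n_gt0 nn no B B_gt0 Bprod pB sz} => // r IH.
by rewrite addSn expnS; lia.
Qed.

Local Open Scope classical_set_scope.
Local Open Scope ring_scope.

(** * Discrepancy of linear maps modulo a prime *)

Section Fourier.
Variables (R : rcfType) (q : nat) (q_pr : prime q).
Local Notation F := 'F_q.
Local Notation C := (complex R).

(** The reciprocal of the distance from [a / q] to the nearest integer; the value [q] at 0 is the
    trivial bound for a geometric sum of at most [q] terms. *)
Definition fourier_weight (a : F) : R :=
  if a == 0 then q%:R else q%:R / (minn a (q - a))%:R.

(** A finite analogue of the Erdos-Turan-Koksma sum: the first product bounds the Fourier
    coefficient at [h] of a box of arcs, the second the exponential sum over a cube at frequency
    [h A]. *)
Definition fourier_bound m d (A : 'M[F]_(m, d)) : R :=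
  \sum_(h : {ffun 'I_m -> F} | h != 0)
    (\prod_i (fourier_weight (h i) / q%:R)) *
    \prod_j fourier_weight (\sum_i h i * A i j).

(** The indicator of the arc [u, ..., u + l - 1] once [l <= q]; as a sum over points it expands in
    characters point by point. *)
Definition arc_count (u : F) (l : nat) (x : F) : R :=
  \sum_(j < l) (x == u + j%:R)%:R.

Let q_gt0 : (0 < q)%N. Proof. exact: prime_gt0. Qed.
Let q_gt1 : (1 < q)%N. Proof. exact: prime_gt1. Qed.

Lemma Fp_lt (a : F) : (a < q)%N.
Proof. by have := ltn_ord a; rewrite [X in (_ < X)%N]Fp_cast. Qed.

Lemma val_FpD (a b : F) : (a + b)%R = ((a + b) %% q)%N :> nat.
Proof. by rewrite /= [X in (_ %% X)%N]Fp_cast. Qed.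

Lemma val_Fp_opp (a : F) : a != 0 -> (- a)%R = (q - a)%N :> nat.
Proof.
move=> a0; rewrite /= [X in (_ %% X)%N]Fp_cast // [X in (X - _)%N]Fp_cast //.
rewrite modn_small //; have : (a : nat) != 0%N by [].
have := Fp_lt a; lia.
Qed.

Lemma fourier_weightN (a : F) : fourier_weight (- a) = fourier_weight a.
Proof.
rewrite /fourier_weight oppr_eq0; case: eqVneq => // a0.
congr (_ / _%:R); rewrite (val_Fp_opp a0); have := Fp_lt a.
by move: (nat_of_ord a) => k; lia.
Qed.

Lemma fourier_weight_ge0 (a : F) : 0 <= fourier_weight a.
Proof. by rewrite /fourier_weight; case: eqP => _; rewrite ?ler0n ?divr_ge0 ?ler0n. Qed.

Lemma fourier_bound_ge0 m d (A : 'M[F]_(m, d)) : 0 <= fourier_bound A.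
Proof.
apply: sumr_ge0 => h _; apply: mulr_ge0; apply: prodr_ge0 => i _.
  by rewrite divr_ge0 ?fourier_weight_ge0 ?ler0n.
exact: fourier_weight_ge0.
Qed.

Section Character.
Variable z : C.
Hypothesis zq : z ^+ q = 1.
Hypothesis z1 : z != 1.
Hypothesis z_geom : forall (a : F) N, a != 0 ->
  `|\sum_(n < N) (z ^+ (a : nat)) ^+ n| <= (fourier_weight a)%:C%C.

Let chi (a : F) : C := z ^+ (a : nat).

Let chiD a b : chi (a + b) = chi a * chi b.
Proof. by rewrite /chi val_FpD expr_mod // exprD. Qed.

Let chi0 : chi 0 = 1. Proof. by rewrite /chi expr0. Qed.

Let chiMn a n : chi (a *+ n) = chi a ^+ n.
Proof. by elim: n => [|n IH]; rewrite ?mulr0n ?expr0 // mulrS chiD IH exprS. Qed.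

Let chi_sum I (r : seq I) (P : pred I) (f : I -> F) :
  chi (\sum_(i <- r | P i) f i) = \prod_(i <- r | P i) chi (f i).
Proof. exact: (big_morph chi chiD chi0). Qed.

Let chi_norm a : `|chi a| = 1.
Proof.
have /eqP : `|chi a| ^+ q = 1 by rewrite -normrX -chiMn -mulr_natr pchar_Fp_0 ?mulr0 ?chi0 ?normr1.
by rewrite pexpr_eq1 // => /eqP.
Qed.

Let chi_orth a : \sum_h chi (h * a) = if a == 0 then q%:R else 0.
Proof.
case: eqVneq => [->|a0].
  under eq_bigr do rewrite mulr0 chi0.
  by rewrite sumr_const card_Fp.
set s := \sum_h _; pose t := \sum_h chi h.
have -> : s = t by rewrite /t (reindex_inj (mulIf a0)).
have : t = chi 1 * t.
  rewrite {1}/t (reindex_inj (addrI 1)) /= mulr_sumr.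
  by apply: eq_bigr => h _; rewrite chiD.
move/eqP; rewrite -subr_eq0 -{1}[t]mul1r -mulrBl mulf_eq0 => /orP[|/eqP//].
by rewrite subr_eq0 /chi expr1 eq_sym (negPf z1).
Qed.

Let arc_coef (u : F) (l : nat) (h : F) : C :=
  q%:R^-1 * chi (- (h * u)) * \sum_(j < l) chi (- h) ^+ j.

Let qC_neq0 : q%:R != 0 :> C. Proof. by rewrite pnatr_eq0 -lt0n. Qed.

Let arc_count_fourier u l x :
  (arc_count u l x)%:C%C = \sum_h chi (h * x) * arc_coef u l h.
Proof.
rewrite /arc_count rmorph_sum /=.
transitivity (\sum_(j < l) q%:R^-1 * \sum_h chi (h * (x - (u + j%:R)))).
  apply: eq_bigr => j _; rewrite chi_orth subr_eq0.
  by case: eqP => _; rewrite ?mulr0 ?rmorph0 // mulVf ?rmorph1.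
under [LHS]eq_bigr => j _ do rewrite mulr_sumr.
rewrite exchange_big /=; apply: eq_bigr => h _.
rewrite /arc_coef !mulr_sumr; apply: eq_bigr => j _.
rewrite -chiMn !mulrA [_ * q%:R^-1]mulrC -!mulrA -!chiD; congr (_ * chi _).
by rewrite mulrBr mulrDr opprD mulNrn mulr_natr.
Qed.

Let arc_coef_le u l h : h != 0 ->
  `|arc_coef u l h| <= (fourier_weight h / q%:R)%:C%C.
Proof.
move=> h0; rewrite /arc_coef !normrM chi_norm mulr1 normfV normr_nat.
rewrite rmorphM /= mulrC fmorphV rmorph_nat ler_wpM2r ?invr_ge0 ?ler0n //.
by rewrite -fourier_weightN z_geom // oppr_eq0.
Qed.

Let arc_coef0 u l : arc_coef u l 0 = l%:R / q%:R.
Proof.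
rewrite /arc_coef mul0r oppr0 chi0 mulr1 mulrC; congr (_ / _).
by under eq_bigr do rewrite expr1n; rewrite sumr_const card_ord.
Qed.

Let geom_le (a : F) N : (N <= q)%N ->
  `|\sum_(n < N) chi a ^+ n| <= (fourier_weight a)%:C%C.
Proof.
move=> Nq; have [->|a0] := eqVneq a 0; last exact: z_geom.
rewrite chi0 /fourier_weight eqxx; under eq_bigr do rewrite expr1n.
by rewrite sumr_const card_ord normr_nat rmorph_nat ler_nat.
Qed.

Let normC_real (x : R) : `|x%:C%C| = `|x|%:C%C :> C.
Proof. by rewrite normc_def /= expr0n /= addr0 sqrtr_sqr. Qed.

(** After expansion of the arcs in characters, the sum over the cube factors into one geometric sum
    per coordinate. The term [h = 0] is the expected count; the others are bounded one by one. *)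
Lemma fourier_discrepancy_char m d (A : 'M[F]_(m, d)) N (T u : 'I_m -> F)
    (l : 'I_m -> nat) : (N <= q)%N -> (forall i, (l i <= q)%N) ->
  `|\sum_(n : {ffun 'I_d -> 'I_N})
      \prod_i arc_count (u i) (l i) (T i - \sum_j A i j * (n j)%:R)
    - N%:R ^+ d * \prod_i ((l i)%:R / q%:R)| <= fourier_bound A.
Proof.
move=> Nq lq; rewrite -lecR -normC_real rmorphB rmorph_sum /=.
pose G (h : {ffun 'I_m -> F}) : C :=
  (\prod_i chi (h i * T i)) * \prod_i arc_coef (u i) (l i) (h i).
pose S (h : {ffun 'I_m -> F}) : C :=
  \prod_j \sum_(n < N) chi (- \sum_i h i * A i j) ^+ n.
have -> : \sum_(n : {ffun 'I_d -> 'I_N})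
    (\prod_i arc_count (u i) (l i) (T i - \sum_j A i j * (n j)%:R))%:C%C
    = \sum_h G h * S h.
  transitivity (\sum_(n : {ffun 'I_d -> 'I_N}) \sum_(h : {ffun 'I_m -> F})
      G h * \prod_j chi (- \sum_i h i * A i j) ^+ n j).
    apply: eq_bigr => n _; rewrite rmorph_prod /=.
    under eq_bigr do rewrite arc_count_fourier.
    rewrite bigA_distr_bigA /=; apply: eq_bigr => h _.
    rewrite big_split /= /G mulrAC; congr (_ * _).
    transitivity (\prod_i chi (h i * T i) *
        \prod_j chi (- (\sum_i h i * A i j) *+ n j)).
      rewrite -!chi_sum -chiD; congr chi.
      under eq_bigr do rewrite mulrBr.
      rewrite sumrB; congr (_ + _).
      under [in RHS]eq_bigr do rewrite mulNrn -sumrMnl.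
      rewrite sumrN exchange_big /=; congr (- _); apply: eq_bigr => i _.
      by rewrite mulr_sumr; apply: eq_bigr => j _; rewrite mulrA mulr_natr.
    by congr (_ * _); apply: eq_bigr => j _; rewrite chiMn.
  rewrite exchange_big /=; apply: eq_bigr => h _.
  by rewrite -mulr_sumr /S bigA_distr_bigA.
rewrite (bigD1 (0 : {ffun 'I_m -> F})) //=.
have z0E i : (0 : {ffun 'I_m -> F}) i = 0 by apply: ffunE.
have -> : G 0 * S 0 = (N%:R ^+ d * \prod_i ((l i)%:R / q%:R))%:C%C.
  rewrite /G /S big1 => [|i _]; last by rewrite z0E mul0r chi0.
  rewrite mul1r rmorphM rmorphXn rmorph_nat rmorph_prod mulrC /=; congr (_ * _).
    rewrite -[X in _ ^+ X](card_ord d) -prodr_const; apply: eq_bigr => j _.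
    have -> : \sum_i (0 : {ffun 'I_m -> F}) i * A i j = 0.
      by apply: big1 => i _; rewrite z0E mul0r.
    rewrite oppr0 chi0; under eq_bigr do rewrite expr1n.
    by rewrite sumr_const card_ord.
  apply: eq_bigr => i _.
  by rewrite z0E arc_coef0 rmorphM fmorphV !rmorph_nat.
rewrite addrAC subrr add0r (le_trans (ler_norm_sum _ _ _)) //.
rewrite /fourier_bound rmorph_sum /=; apply: ler_sum => h h0.
rewrite normrM rmorphM /= ler_pM ?normr_ge0 //.
  rewrite /G normrM normr_prod big1 => [|i _]; last exact: chi_norm.
  rewrite mul1r normr_prod rmorph_prod; apply: ler_prod => i _.
  (* A nonzero [h] may have zero coordinates; there the coefficient is [l i / q], at most 1 because
     [l i <= q]. *)
  rewrite normr_ge0 /=; have [hi0|hi0] := eqVneq (h i) 0; last exact: arc_coef_le.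
  rewrite hi0 arc_coef0 /fourier_weight eqxx rmorphM fmorphV !rmorph_nat.
  rewrite normrM normfV !normr_nat ler_wpM2r ?invr_ge0 ?ler0n // ler_nat.
  exact: lq.
rewrite /S normr_prod rmorph_prod /=; apply: ler_prod => j _.
by rewrite normr_ge0 -fourier_weightN geom_le.
Qed.

End Character.

(* With [k = floor(q / 2b)] the point [z^(b k)] lies in the left half plane, hence
   [1 <= |1 - z^(b k)| <= k |1 - z^b|]. *)
Lemma character_gap (z : C) b : `|z| = 1 -> z ^+ q = 1 ->
  (forall j, (q <= 4 * j)%N -> (2 * j <= q)%N -> complex.Re (z ^+ j) <= 0) ->
  (0 < b)%N -> (b < q)%N ->
  2 * (minn b (q - b))%:R / q%:R <= `|1 - z ^+ b|.
Proof.
move=> nz zq zj.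
have nzX n : `|z ^+ n| = 1 by rewrite normrX nz expr1n.
have small c : (0 < c)%N -> (2 * c <= q)%N -> 2 * c%:R / q%:R <= `|1 - z ^+ c|.
  move=> c_gt0 cq; set k := (q %/ (2 * c))%N.
  have k_gt0 : (0 < k)%N by rewrite divn_gt0 // muln_gt0.
  have kq : (k * (2 * c) <= q)%N by rewrite leq_divM.
  have qk : (q < k.+1 * (2 * c))%N by rewrite ltn_ceil // muln_gt0.
  (* Since [k >= 1], [q < 2c (k + 1) <= 4ck], while [2ck <= q] by the choice of [k]. *)
  have re0 : complex.Re (z ^+ (c * k)) <= 0 by apply: zj; nia.
  have h1 : 1 <= `|1 - z ^+ (c * k)|.
    rewrite normc_def -[1]/(1%:C%C) lecR -[leLHS]sqrtr1 ler_sqrt; last first.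
      by rewrite addr_ge0 ?sqr_ge0.
    move: re0; case: (z ^+ (c * k)) => x y /= x0.
    by have := sqr_ge0 y; nra.
  have h2 : `|1 - z ^+ (c * k)| <= k%:R * `|1 - z ^+ c|.
    rewrite exprM distrC subrX1 normrM mulrC distrC ler_wpM2r ?normr_ge0 //.
    apply: le_trans (ler_norm_sum _ _ _) _.
    under eq_bigr do rewrite normrX nzX expr1n.
    by rewrite sumr_const card_ord.
  rewrite ler_pdivrMr ?ltr0n //.
  have kC : 0 < (k%:R : C) by rewrite ltr0n.
  rewrite -(ler_pM2l kC) [leRHS]mulrA.
  apply: (@le_trans _ _ q%:R).
    by rewrite -!natrM ler_nat.
  rewrite -[leLHS]mul1r ler_wpM2r ?ler0n //.
  exact: le_trans h1 h2.
move=> b_gt0 bq; have [h|h] := leqP (2 * b) q.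
  by rewrite (minn_idPl _); [exact: small | lia].
rewrite (minn_idPr _); last by lia.
have -> : `|1 - z ^+ b| = `|1 - z ^+ (q - b)|.
  rewrite -[RHS]mul1r -{2}(nzX b) -normrM mulrBr mulr1 -exprD subnKC 1?ltnW //.
  by rewrite zq distrC.
by apply: small; lia.
Qed.

(** In absolute value the numerator of [(x^N - 1) / (x - 1)] is at most 2 and the denominator at
    least [2 min(a, q - a) / q]. *)
Lemma character_geometric (z : C) (a : F) N : `|z| = 1 -> z ^+ q = 1 ->
  (forall j, (q <= 4 * j)%N -> (2 * j <= q)%N -> complex.Re (z ^+ j) <= 0) ->
  a != 0 ->
  `|\sum_(n < N) (z ^+ (a : nat)) ^+ n| <= (fourier_weight a)%:C%C.
Proof.
move=> nz zq zj a0; have aq := Fp_lt a.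
have a_gt0 : (0 < a)%N by rewrite lt0n.
rewrite /fourier_weight (negPf a0) rmorphM fmorphV !rmorph_nat.
have := character_gap nz zq zj a_gt0 aq.
move: (nat_of_ord a) aq a_gt0 => b bq b_gt0 {a a0}.
set x := z ^+ b; set M := minn _ _ => gap.
have M_gt0 : 0 < (M%:R : C) by rewrite ltr0n /M; lia.
have qC : 0 < (q%:R : C) by rewrite ltr0n.
have nx : `|x| = 1 by rewrite normrX nz expr1n.
have : `|x - 1| * `|\sum_(n < N) x ^+ n| <= 2.
  rewrite -normrM -subrX1 (le_trans (ler_normB _ _)) //.
  by rewrite normrX nx expr1n normr1.
rewrite distrC => le2; rewrite ler_pdivlMr // mulrC.
have := ler_wpM2r (normr_ge0 (\sum_(n < N) x ^+ n)) gap.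
by move/le_trans/(_ le2); rewrite mulrAC ler_pdivrMr // -mulrA ler_pM2l.
Qed.

(** Dyadic blocks: the [2^r] terms from [2^r] to [2^(r+1) - 1] are at most [2^-r] each and add at
    most 1. *)
Lemma sum_inv_le r : \sum_(1 <= i < (2 ^ r)%N) (i%:R^-1 : R) <= r%:R.
Proof.
elim: r => [|r IH]; first by rewrite big_geq.
have h : (0 < 2 ^ r)%N by rewrite expn_gt0.
rewrite (big_cat_nat (n := (2 ^ r)%N)) //=; last by rewrite leq_exp2l.
rewrite -natr1 lerD //.
apply: (@le_trans _ _ (\sum_(2 ^ r <= i < 2 ^ r.+1) ((2 ^ r)%:R^-1 : R))).
  rewrite big_nat_cond [leRHS]big_nat_cond; apply: ler_sum => i.
  by move=> /andP[/andP[li _] _]; rewrite lef_pV2 ?posrE ?ltr0n ?ler_nat //; lia.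
rewrite sumr_const_nat expnS mul2n -addnn addnK -[leLHS]mulr_natr.
by rewrite mulVf // pnatr_eq0 -lt0n.
Qed.

(** [1 / min(a, q - a)] is replaced by [1 / a + 1 / (q - a)], and the reflection [a -> - a] gives
    both halves the same sum. *)
Lemma sum_fourier_weight r : (q <= 2 ^ r)%N ->
  \sum_a fourier_weight a <= q%:R * (1 + 2 * r%:R).
Proof.
move=> qr; rewrite (bigD1 (0 : F)) //= {1}/fourier_weight eqxx mulrDr mulr1 lerD2l.
have wle (a : F) : a != 0 ->
    fourier_weight a <= q%:R * ((a : nat)%:R^-1 + (q - a)%:R^-1).
  move=> a0; rewrite /fourier_weight (negPf a0) ler_wpM2l ?ler0n //.
  rewrite /minn; case: ltnP => _; first by rewrite lerDl invr_ge0 ler0n.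
  by rewrite lerDr invr_ge0 ler0n.
apply: le_trans (ler_sum _ wle) _; rewrite -mulr_sumr ler_wpM2l ?ler0n //.
have H : \sum_(a : F | a != 0) ((a : nat)%:R^-1 : R) <= r%:R.
  apply: le_trans (sum_inv_le r).
  apply: (@le_trans _ _ (\sum_(1 <= i < q) (i%:R^-1 : R))).
    have -> : \sum_(a : F | a != 0) ((a : nat)%:R^-1 : R)
        = \sum_(i < (Zp_trunc (pdiv q)).+2 | i != 0%N :> nat) (i%:R^-1 : R).
      by apply: eq_bigl => i.
    rewrite -(big_mkord (fun i => i != 0%N) (fun i => i%:R^-1)) Fp_cast //.
    rewrite big_ltn_cond //= big_nat_cond.
    rewrite [X in X <= _](_ : _ = \sum_(1 <= i < q) (i%:R^-1 : R)) //.
    by rewrite [RHS]big_nat_cond; apply: eq_bigl => -[|i]; rewrite ?andbF ?andbT.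
  have q_ge1 : (1 <= q)%N := q_gt0.
  rewrite [leRHS](big_cat_nat q_ge1 qr) /= lerDl; apply: sumr_ge0 => i _.
  by rewrite invr_ge0 ler0n.
rewrite big_split /= (mulrDl 1 1) mul1r lerD //.
rewrite (reindex_inj oppr_inj) (eq_bigl (fun a => a != 0)) => [|a]; last first.
  by rewrite oppr_eq0.
apply: le_trans H; apply: ler_sum => a a0.
have aq := Fp_lt a; have e := val_Fp_opp a0.
rewrite -[X in (q - X)%N]/(nat_of_ord (- a)) e subKn //; exact: ltnW.
Qed.
(** If [h i0 != 0], adding [b / h i0] to row [i0] of [A] translates [h A] by [b]. The factor [q^d]
    counts these translations; summing over them first turns each factor into the sum of all
    weights. *)
Lemma sum_matrix_weight m d (h : {ffun 'I_m -> F}) : h != 0 ->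
  q%:R ^+ d * \sum_(A : 'M[F]_(m, d)) \prod_j fourier_weight (\sum_i h i * A i j)
  = (q ^ (m * d))%:R * (\sum_a fourier_weight a) ^+ d.
Proof.
move=> h0; have [i0 hi0] : exists i0, h i0 != 0.
  apply/existsP; rewrite -negb_forall; apply: contra h0 => /forallP h0.
  apply/eqP/ffunP => i; rewrite (eqP (h0 i)); apply/esym; exact: ffunE.
set W := \sum_a fourier_weight a; pose hA (A : 'M[F]_(m, d)) j := \sum_i h i * A i j.
pose B (b : {ffun 'I_d -> F}) : 'M[F]_(m, d) :=
  \matrix_(i, j) (if i == i0 then b j / h i0 else 0).
have hB A b j : hA (A + B b) j = hA A j + b j.
  rewrite /hA; under eq_bigr do rewrite mxE mulrDr.
  rewrite big_split /=; congr (_ + _).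
  rewrite (bigD1 i0) //= mxE eqxx mulrCA divff // mulr1 big1 ?addr0 // => i ii0.
  by rewrite mxE (negPf ii0) mulr0.
transitivity (\sum_(b : {ffun 'I_d -> F})
    \sum_(A : 'M[F]_(m, d)) \prod_j fourier_weight (hA A j)).
  rewrite sumr_const card_ffun [#|'I_d|]card_ord [X in (X ^ _)%N](card_Fp q_pr).
  by rewrite -natrX mulr_natl.
transitivity (\sum_(A : 'M[F]_(m, d)) \sum_(b : {ffun 'I_d -> F})
    \prod_j fourier_weight (hA A j + b j)).
  rewrite [RHS]exchange_big /=; apply: eq_bigr => b _.
  rewrite (reindex_inj (addIr (B b))) /=; apply: eq_bigr => A _.
  by apply: eq_bigr => j _; rewrite hB.
transitivity (\sum_(A : 'M[F]_(m, d)) W ^+ d).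
  apply: eq_bigr => A _.
  rewrite -(bigA_distr_bigA (fun j x => fourier_weight (hA A j + x))) /=.
  rewrite -[X in _ ^+ X](card_ord d) -prodr_const; apply: eq_bigr => j _.
  by rewrite /W [RHS](reindex_inj (addrI (hA A j))).
by rewrite sumr_const card_mx [X in (X ^ _)%N](card_Fp q_pr) mulr_natl.
Qed.

Lemma sum_fourier_bound m d r : (q <= 2 ^ r)%N ->
  \sum_(A : 'M[F]_(m, d)) fourier_bound A
  <= (q ^ (m * d))%:R * (1 + 2 * r%:R) ^+ (m + d).
Proof.
move=> qr; have W_le := sum_fourier_weight qr.
have qR : 0 < (q%:R : R) by rewrite ltr0n.
have L0 : 0 <= 1 + 2 * r%:R :> R by rewrite addr_ge0 ?mulr_ge0 ?ler0n.
have W_ge0 : 0 <= \sum_a fourier_weight a by apply: sumr_ge0 => a _; exact: fourier_weight_ge0.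
rewrite exchange_big /=.
apply: (@le_trans _ _ (\sum_(h : {ffun 'I_m -> F})
    (\prod_i (fourier_weight (h i) / q%:R)) *
      ((q ^ (m * d))%:R * (1 + 2 * r%:R) ^+ d))).
  (* A nonnegative term at [h = 0] is added, so that the sum over all [h] factors into [m] sums over
     the field. *)
  rewrite [leRHS](bigD1 (0 : {ffun 'I_m -> F})) //= -[leLHS]add0r lerD //.
    rewrite mulr_ge0 ?mulr_ge0 ?ler0n ?exprn_ge0 //.
    by apply: prodr_ge0 => i _; rewrite divr_ge0 ?fourier_weight_ge0 ?ler0n.
  apply: ler_sum => h h0; rewrite -mulr_sumr ler_wpM2l //.
    by apply: prodr_ge0 => i _; rewrite divr_ge0 ?fourier_weight_ge0 ?ler0n.
  rewrite -(ler_pM2l (exprn_gt0 d qR)) sum_matrix_weight // mulrCA.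
  by rewrite ler_wpM2l ?ler0n // -exprMn lerXn2r ?nnegrE ?mulr_ge0 ?ler0n.
rewrite -mulr_suml -(bigA_distr_bigA (fun _ x => fourier_weight x / q%:R)) /=.
rewrite prodr_const card_ord -mulr_suml exprD mulrC -!mulrA ler_wpM2l ?ler0n //.
rewrite mulrC ler_wpM2r ?exprn_ge0 // lerXn2r ?nnegrE ?divr_ge0 ?ler0n //.
by rewrite ler_pdivrMr // mulrC.
Qed.

End Fourier.

(** [z = exp(2 pi i / q)]. The last clause, that angles from [pi / 2] to [pi] have nonpositive
    cosine, is the only trigonometric input of the estimates above, which hold over any real closed
    field. *)
Lemma exists_character (R : realType) (q : nat) : (1 < q)%N ->
  exists z : complex R, [/\ `|z| = 1, z ^+ q = 1, z != 1
    & forall j, (q <= 4 * j)%N -> (2 * j <= q)%N -> complex.Re (z ^+ j) <= 0].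
Proof.
move=> q_gt1; pose t : R := 2 * pi / q%:R; have q0 : (0 < (q%:R : R)) by rewrite ltr0n ltnW.
pose z : complex R := Complex (cos t) (sin t).
have zX n : z ^+ n = Complex (cos (n%:R * t)) (sin (n%:R * t)).
  elim: n => [|n IH]; first by rewrite mul0r cos0 sin0 expr0.
  rewrite exprS IH -natr1 mulrDl mul1r cosD sinD /=.
  by apply/eqP; rewrite eq_complex /=; apply/andP; split; apply/eqP; ring.
have zj j : (q <= 4 * j)%N -> (2 * j <= q)%N -> complex.Re (z ^+ j) <= 0.
  rewrite -(ler_nat R) -[(2 * j <= q)%N](ler_nat R) !natrM zX /= => h1 h2.
  have p0 := pi_gt0 R.
  have e : cos (j%:R * t) = - cos (j%:R * t - pi).
    by rewrite cosB cospi sinpi mulr0 addr0 mulrN1 opprK.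
  have jt : j%:R * t = (2 * j%:R) * pi / q%:R by rewrite /t; field; rewrite gt_eqF.
  rewrite e oppr_le0 cos_ge0_pihalf // jt; apply/andP; split.
    rewrite lerBrDr ler_pdivlMr //; nra.
  by rewrite lerBlDr ler_pdivrMr //; nra.
exists z; split => //.
- rewrite normc_def /= cos2Dsin2 sqrtr1 //.
- have -> : z ^+ q = Complex (cos (pi *+ 2)) (sin (pi *+ 2)).
    by rewrite zX; congr Complex; congr (_ _); rewrite /t mulrC divfK ?gt_eqF // mulr_natl.
  by rewrite cos2pi sin2pi.
- apply/eqP => z1; have := zj (q %/ 2)%N.
  rewrite z1 expr1n /=; have := ler10 R.
  have h1 : (q <= 4 * (q %/ 2))%N by lia.
  have h2 : (2 * (q %/ 2) <= q)%N by lia.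
  by move=> h /(_ h1 h2); rewrite ler10.
Qed.

(** * Discrepancy of real linear maps on the torus *)

Definition frac (R : realType) (x : R) : R := x - (Num.floor x)%:~R.

Lemma frac_itv (R : realType) (x : R) : 0 <= frac x < 1.
Proof.
by rewrite /frac; have /andP[] := floor_itv x; rewrite intrD1 => h1 h2; apply/andP; split; lra.
Qed.

Lemma frac_eq (R : realType) (x : R) (e : int) : 0 <= x - e%:~R < 1 -> frac x = x - e%:~R.
Proof.
move=> /andP[h1 h2]; rewrite /frac (@floor_def _ x e) //.
by rewrite intrD1; apply/andP; split; lra.
Qed.

(** On [[0, 1]] a product is 1-Lipschitz in each factor, so the errors add up. *)
Lemma prodr_le_add (R : realDomainType) (I : Type) (r : seq I) (u v : I -> R) (e : R) :
  0 <= e -> (forall i, 0 <= u i <= 1) -> (forall i, 0 <= v i <= 1) ->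
  (forall i, u i <= v i + e) ->
  \prod_(i <- r) u i <= \prod_(i <- r) v i + (size r)%:R * e.
Proof.
move=> e0 u01 v01 uv; elim: r => [|i r IH]; first by rewrite !big_nil mul0r addr0.
rewrite !big_cons /= -natr1.
have : 0 <= \prod_(j <- r) u j <= 1.
  rewrite prodr_ge0 /=; last by move=> j _; have /andP[] := u01 j.
  by apply: prodr_ile1 => j _.
have E0 : 0 <= (size r)%:R * e by rewrite mulr_ge0 ?ler0n.
move: (u01 i) (v01 i) (uv i) IH E0; rewrite mulrDl mul1r.
move: (\prod_(j <- r) u j) (\prod_(j <- r) v j) ((size r)%:R * e) => U V E.
move=> /andP[u0 u1] /andP[v0 v1] uve UVE E0 /andP[U0 U1].
have h1 : u i * U <= (v i + e) * U by rewrite ler_wpM2r.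
have h2 : v i * U <= v i * (V + E) by rewrite ler_wpM2l.
have h3 : v i * E <= E by rewrite ler_piMl.
have h4 : e * U <= e by rewrite ler_piMr.
move: h1 h2; rewrite mulrDl mulrDr; lra.
Qed.

Lemma arc_discrepancy (R : realType) (q : nat) m d (A : 'M['F_q]_(m, d)) N
    (T u : 'I_m -> 'F_q) (l : 'I_m -> nat) :
  prime q -> (N <= q)%N -> (forall i, (l i <= q)%N) ->
  `|\sum_(n : {ffun 'I_d -> 'I_N})
      \prod_i arc_count R (u i) (l i) (T i - \sum_j A i j * (n j)%:R)
    - N%:R ^+ d * \prod_i ((l i)%:R / q%:R)| <= fourier_bound R A.
Proof.
move=> q_pr Nq lq; have [z [nz zq z1 zj]] := exists_character R (prime_gt1 q_pr).
apply: (fourier_discrepancy_char q_pr zq z1) => // a M a0.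
exact: character_geometric.
Qed.

(** * Arcs of residues around an interval *)

Section OneDim.
Variables (R : realType) (q : nat) (q_pr : prime q).
Implicit Types (a b y : R) (X : int) (K : nat).

(** An orbit point [y] comes with an integer [X] such that [X - K <= q y < X + 1]. The outer arc
    contains every residue [X] possible for [y] in [[a, b]], and is capped at [q] to avoid
    repetitions; the inner arc is shortened by the same margin, natural subtraction making it empty
    for short intervals. *)
Definition outer_length a b K := minn (Num.truncn (q%:R * (b - a)) + K + 2)%N q.
Definition inner_length a b K := (Num.truncn (q%:R * (b - a)) - (K + 2))%N.
Definition outer_start a : 'F_q := (Num.floor (q%:R * a))%:~R.
Definition inner_start a K : 'F_q := (Num.floor (q%:R * a) + 1 + K%:Z)%:~R.

Let q_gt0 : (0 : R) < q%:R. Proof. by rewrite ltr0n prime_gt0. Qed.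

Let qba_ge0 a b : a <= b -> 0 <= q%:R * (b - a).
Proof. by move=> ab; rewrite mulr_ge0 // ?ler0n // subr_ge0. Qed.

Lemma inner_length_le a b K : 0 <= a -> a <= b -> b <= 1 ->
  (inner_length a b K <= q)%N.
Proof.
move=> a0 ab b1.
apply: leq_trans (leq_subr _ _) _; rewrite -(ler_nat R).
apply: (@le_trans _ _ (q%:R * (b - a))); first by rewrite truncn_le (qba_ge0 ab).
rewrite -[leRHS]mulr1 (ler_wpM2l (ltW q_gt0)) //. lra.
Qed.

Lemma outer_length_bound a b K : a <= b ->
  (outer_length a b K)%:R / q%:R <= (b - a) + (K%:R + 3) / q%:R.
Proof.
move=> ab.
rewrite ler_pdivrMr // mulrDl divfK ?gt_eqF // [_ * q%:R]mulrC.
apply: (@le_trans _ _ (Num.truncn (q%:R * (b - a)) + K + 2)%:R).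
  by rewrite ler_nat geq_minl.
by have := truncn_le (q%:R * (b - a)); rewrite (qba_ge0 ab) !natrD; lra.
Qed.

Lemma inner_length_bound a b K :
  b - a <= (inner_length a b K)%:R / q%:R + (K%:R + 3) / q%:R.
Proof.
have q0 := q_gt0.
rewrite -mulrDl ler_pdivlMr // mulrC.
have := truncnS_gt (q%:R * (b - a)); rewrite -natr1.
have : (Num.truncn (q%:R * (b - a)) <= inner_length a b K + (K + 2))%N.
  by rewrite /inner_length; lia.
by rewrite -(ler_nat R) !natrD; lra.
Qed.

Lemma arc_count_le1 (u x : 'F_q) l : (l <= q)%N -> arc_count R u l x <= 1.
Proof.
move=> lq; rewrite /arc_count.
have [/existsP[j0 /eqP xj0]|] := boolP [exists j : 'I_l, x == u + j%:R]; last first.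
  rewrite negb_exists => /forallP h; rewrite big1 // => j _.
  by rewrite (negPf (h j)).
rewrite (bigD1 j0) //= xj0 eqxx big1 ?addr0 // => j jj0.
case: eqP => // /addrI /(congr1 (@nat_of_ord _)) e.
have := e; rewrite !val_Fp_nat // !modn_small ?(leq_trans (ltn_ord _)) // => e'.
by move: jj0; rewrite -(inj_eq val_inj) /= -e' eqxx.
Qed.

Lemma inner_arc_le a b y X K : 0 <= a -> a <= b -> b <= 1 ->
  X%:~R - K%:R <= q%:R * y -> q%:R * y < X%:~R + 1 ->
  arc_count R (inner_start a K) (inner_length a b K) X%:~R
    <= (a <= frac y <= b)%R%:R.
Proof.
move=> a0 ab b1 Xy yX; have q0 := q_gt0.
have [/existsP[j /eqP Xj]|] :=
  boolP [exists j : 'I_(inner_length a b K), X%:~R == inner_start a K + j%:R]; last first.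
  rewrite negb_exists => /forallP h; rewrite /arc_count big1 ?ler0n // => j _.
  by rewrite (negPf (h j)).
apply: le_trans (arc_count_le1 _ _ (inner_length_le _ a0 ab b1)) _.
(* Membership in the arc fixes [X] only modulo [q]. The bounds below put [y - e] strictly between
   [a] and [b], inside [[0, 1]], which identifies [e] as the floor of [y]. *)
have [e Xe] : exists e : int, X = Num.floor (q%:R * a) + 1 + K%:Z + j%:Z + q%:Z * e.
  have : (X - (Num.floor (q%:R * a) + 1 + K%:Z + j%:Z))%:~R == 0 :> 'F_q.
    by rewrite rmorphB /= Xj /inner_start !rmorphD /= subr_eq0.
  rewrite -(dvdz_pcharf (pchar_Fp q_pr)) => /dvdzP[e He].
  by exists e; rewrite [q%:Z * e]mulrC -He; ring.
have /andP[f1 f2] := floor_itv (q%:R * a).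
have jl : j%:R + K%:R + 2 < q%:R * (b - a).
  have := ltn_ord j; rewrite /inner_length => jl.
  apply: lt_le_trans (_ : (Num.truncn (q%:R * (b - a)))%:R <= _).
    by rewrite -addrA -!natrD ltr_nat; lia.
  by have := truncn_le (q%:R * (b - a)); rewrite (qba_ge0 ab).
move: Xy yX f2; rewrite {}Xe !rmorphD /= rmorphM /=.
set f := (Num.floor _)%:~R in f1 *; rewrite -!pmulrn => h1 h2 f2.
have j0 : 0 <= j%:R :> R by [].
have h3 : q%:R * a < q%:R * (y - e%:~R) by rewrite mulrBr; lra.
have h4 : q%:R * (y - e%:~R) < q%:R * b by move: jl; rewrite !mulrBr; lra.
move: h3 h4; rewrite !ltr_pM2l // => h3 h4.
have -> : frac y = y - e%:~R by apply: frac_eq; apply/andP; split; lra.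
by rewrite (ltW h3) (ltW h4).
Qed.

Lemma outer_arc_ge a b y X K :
  X%:~R - K%:R <= q%:R * y -> q%:R * y < X%:~R + 1 ->
  (a <= frac y <= b)%R%:R
    <= arc_count R (outer_start a) (outer_length a b K) X%:~R.
Proof.
move=> Xy yX; have q0 := q_gt0.
have [/andP[h1 h2]|_] := boolP (a <= frac y <= b); last first.
  by apply: sumr_ge0 => j _; rewrite ler0n.
have /andP[f1 f2] := floor_itv (q%:R * a).
pose k := X - q%:Z * Num.floor y.
have kR : k%:~R = X%:~R - q%:R * (Num.floor y)%:~R :> R.
  by rewrite /k rmorphB rmorphM.
have h3 : k%:~R - K%:R <= q%:R * frac y by rewrite kR /frac mulrBr; lra.
have h4 : q%:R * frac y < k%:~R + 1 by rewrite kR /frac mulrBr; lra.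
have h5 : q%:R * a <= q%:R * frac y by rewrite ler_pM2l.
have h6 : q%:R * frac y <= q%:R * b by rewrite ler_pM2l.
have [j kj] : exists j : nat, k = Num.floor (q%:R * a) + j%:Z.
  exists `|k - Num.floor (q%:R * a)|%N.
  rewrite gez0_abs ?subrKC // subr_ge0 -ltzD1 -(ltr_int R) intrD1; lra.
have jl : (j < Num.truncn (q%:R * (b - a)) + K + 2)%N.
  rewrite -(ltr_nat R) !natrD.
  have := truncnS_gt (q%:R * (b - a)); rewrite -natr1 mulrBr.
  move: h3 f2; rewrite kj !rmorphD /= -pmulrn; lra.
have jq : (j %% q < outer_length a b K)%N.
  rewrite /outer_length leq_min ltn_pmod ?prime_gt0 // andbT.
  exact: leq_ltn_trans (leq_mod _ _) jl.
have kF : X%:~R = outer_start a + (j %% q)%:R :> 'F_q.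
  rewrite Fp_nat_mod // /outer_start -[j%:R]/(j%:Z%:~R) -rmorphD /= -kj /k.
  by rewrite rmorphB rmorphM /= -pmulrn pchar_Fp_0 // mul0r subr0.
by rewrite /arc_count (bigD1 (Ordinal jq)) //= kF eqxx lerDl sumr_ge0.
Qed.

End OneDim.

Definition torus_point (R : realType) m d (L : 'M[R]_(m, d)) (t : 'I_m -> R)
    (n : 'I_d -> R) (i : 'I_m) : R :=
  frac (t i - \sum_j L i j * n j).

(** Cubes based at the origin suffice: moving the corner amounts to changing [t], and the
    discrepancy bounds are uniform in [t]. *)
Definition box_count (R : realType) m d (L : 'M[R]_(m, d)) (N : nat)
    (t a b : 'I_m -> R) : R :=
  \sum_(n : {ffun 'I_d -> 'I_N})
    \prod_i (a i <= torus_point L t (fun j => (n j)%:R) i <= b i)%R%:R.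

(** The maximum with 0 covers boxes with some [b i < a i], which [fits_box] may produce as
    intersections. *)
Definition box_volume (R : realType) m (a b : 'I_m -> R) : R :=
  \prod_i Num.max 0 (b i - a i).

Section BoxDiscrepancy.
Variables (R : realType) (q : nat) (q_pr : prime q) (m d N : nat).
Hypothesis Nq : (N <= q)%N.
Variables (L : 'M[R]_(m, d)) (c : 'M[int]_(m, d)) (A : 'M['F_q]_(m, d)).
Hypothesis LA : forall i j,
  (c i j)%:~R + (A i j : nat)%:R / q%:R <= L i j
    <= (c i j)%:~R + ((A i j : nat)%:R + 1) / q%:R.

Let K := (d * N)%N.
Let q_gt0 : (0 : R) < q%:R. Proof. by rewrite ltr0n prime_gt0. Qed.

(** [q L i j] exceeds the integer [A i j + q c i j] by at most 1 and [n j < N], so rounding [L]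
    costs at most [K = d N] downwards, and rounding [q t] less than 1 upwards. Modulo [q] the
    integer parts [c] disappear. *)
Lemma grid_approximation (t : 'I_m -> R) (n : {ffun 'I_d -> 'I_N}) i :
  exists X : int,
  [/\ X%:~R - K%:R <= q%:R * (t i - \sum_j L i j * (n j)%:R),
      q%:R * (t i - \sum_j L i j * (n j)%:R) < X%:~R + 1
    & X%:~R = (Num.floor (q%:R * t i))%:~R - \sum_j A i j * (n j)%:R :> 'F_q].
Proof.
have q0 := q_gt0.
pose S := \sum_j ((A i j : nat)%:Z + q%:Z * c i j) * (n j : nat)%:Z.
exists (Num.floor (q%:R * t i) - S).
have SR : S%:~R = \sum_j ((A i j : nat)%:R + q%:R * (c i j)%:~R) * (n j)%:R :> R.
  rewrite /S rmorph_sum /=; apply: eq_bigr => j _.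
  by rewrite rmorphM rmorphD rmorphM /= -!pmulrn.
have h : 0 <= q%:R * (\sum_j L i j * (n j)%:R) - S%:~R <= K%:R.
  have key j : 0 <= q%:R * (L i j * (n j)%:R) -
      ((A i j : nat)%:R + q%:R * (c i j)%:~R) * (n j)%:R <= N%:R.
    have /andP[] := LA i j.
    rewrite -(ler_pM2l q_gt0) => h1; rewrite -(ler_pM2l q_gt0) => h2.
    move: h1 h2; rewrite !mulrDr !mulrA ![q%:R * _ / q%:R]mulrAC divff ?gt_eqF // mul1r.
    move=> h1 h2.
    have n0 : 0 <= (n j)%:R :> R by [].
    have nN : (n j)%:R <= N%:R :> R by rewrite ler_nat ltnW.
    rewrite -mulrBl; apply/andP; split; first by rewrite mulr_ge0 //; lra.
    by apply: le_trans nN; rewrite ler_piMl //; lra.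
  rewrite SR mulr_sumr -sumrB; apply/andP; split.
    by apply: sumr_ge0 => j _; have /andP[] := key j.
  have -> : K%:R = \sum_(j < d) N%:R :> R.
    by rewrite sumr_const card_ord /K natrM mulr_natl.
  by apply: ler_sum => j _; have /andP[] := key j.
have /andP[f1 f2] := floor_itv (q%:R * t i).
move: f2 h; rewrite intrD1 => f2 /andP[h1 h2].
split; first by rewrite rmorphB /= mulrBr; lra.
  by rewrite rmorphB /= mulrBr; lra.
rewrite rmorphB /=; congr (_ - _); rewrite /S rmorph_sum /=.
apply: eq_bigr => j _; rewrite rmorphM rmorphD rmorphM /= -!pmulrn.
by rewrite pchar_Fp_0 // mul0r addr0 natr_Zp.
Qed.

(** The box is squeezed between products of inner and of outer arcs. Divided by [q], the arc lengths
    fall short of or exceed the sides by at most [(K + 3) / q], which costs [m (K + 3) / q] in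
    volume. *)
Lemma box_count_discrepancy (t a b : 'I_m -> R) :
  (forall i, 0 <= a i) -> (forall i, b i <= 1) ->
  `|box_count L N t a b - N%:R ^+ d * box_volume a b|
    <= fourier_bound R A + N%:R ^+ d * (m%:R * ((K%:R + 3) / q%:R)).
Proof.
move=> a0 b1; have q0 := q_gt0.
have e0 : 0 <= (K%:R + 3) / q%:R :> R by rewrite divr_ge0 ?ler0n // addr_ge0.
have FA0 := fourier_bound_ge0 R A.
have Nd0 : 0 <= N%:R ^+ d :> R by rewrite exprn_ge0.
have m0 : 0 <= m%:R :> R by [].
have [/forallP ab|/forallPn[i0]] := boolP [forall i : 'I_m, a i <= b i]; last first.
  rewrite -ltNge => ba.
  have -> : box_volume a b = 0.
    by rewrite /box_volume (bigD1 i0) //= max_l ?mul0r // subr_le0 ltW.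
  have -> : box_count L N t a b = 0.
    apply: big1 => n _; rewrite (bigD1 i0) //=.
    case: andP => [[h1 h2]|]; last by rewrite mul0r.
    by have := le_lt_trans (le_trans h1 h2) ba; rewrite ltxx.
  by rewrite mulr0 subrr normr0 addr_ge0 // !mulr_ge0.
have vE : box_volume a b = \prod_i (b i - a i).
  by apply: eq_bigr => i _; rewrite max_r // subr_ge0.
have v01 i : 0 <= b i - a i <= 1.
  by have := ab i; have := a0 i; have := b1 i; move=> *; apply/andP; split; lra.
pose T i : 'F_q := (Num.floor (q%:R * t i))%:~R.
have lmax i : (outer_length q (a i) (b i) K <= q)%N by exact: geq_minr.
have lmin i : (inner_length q (a i) (b i) K <= q)%N by exact: inner_length_le.
have szI : size (index_enum 'I_m) = m.
  by rewrite -[RHS]card_ord cardT enumT.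
have upper : box_count L N t a b <= N%:R ^+ d * box_volume a b
    + (fourier_bound R A + N%:R ^+ d * (m%:R * ((K%:R + 3) / q%:R))).
  have /ler_distlDr := arc_discrepancy R A T (fun i => outer_start q (a i)) q_pr Nq lmax.
  move=> h; apply: le_trans (le_trans _ h) _.
    apply: ler_sum => n _; apply: ler_prod => i _; rewrite ler0n /=.
    have [X [X1 X2 <-]] := grid_approximation t n i.
    exact: outer_arc_ge.
  rewrite vE [leRHS]addrCA [leLHS]addrC lerD2l -mulrDr ler_wpM2l //.
  have := @prodr_le_add R _ (index_enum 'I_m)
    (fun i => (outer_length q (a i) (b i) K)%:R / q%:R) _ _ e0 _ v01 _.
  rewrite szI; apply => i; last exact: outer_length_bound.
  by rewrite divr_ge0 //= ler_pdivrMr // mul1r ler_nat.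
have lower : N%:R ^+ d * box_volume a b
    - (fourier_bound R A + N%:R ^+ d * (m%:R * ((K%:R + 3) / q%:R)))
    <= box_count L N t a b.
  have /ler_distlCBl := arc_discrepancy R A T (fun i => inner_start q (a i) K) q_pr Nq lmin.
  move=> h; apply: le_trans (le_trans _ h) _; last first.
    apply: ler_sum => n _; apply: ler_prod => i _.
    rewrite sumr_ge0 //=; have [X [X1 X2 <-]] := grid_approximation t n i.
    exact: inner_arc_le.
  rewrite vE opprD addrA addrAC lerB // lerBlDr -mulrDr ler_wpM2l //.
  have := @prodr_le_add R _ (index_enum 'I_m) _
    (fun i => (inner_length q (a i) (b i) K)%:R / q%:R) _ e0 v01 _ _.
  rewrite szI; apply => i; last exact: inner_length_bound.
  by rewrite divr_ge0 //= ler_pdivrMr // mul1r ler_nat.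
by rewrite ler_distl lower upper.
Qed.

End BoxDiscrepancy.

(** * Almost all linear maps *)

Lemma ler_sum_subseq (R : numDomainType) (T : eqType) (s t : seq T) (g : T -> R) :
  uniq s -> uniq t -> {subset s <= t} -> (forall x, 0 <= g x) ->
  \sum_(x <- s) g x <= \sum_(x <- t) g x.
Proof.
move=> us ut st g0.
have /(perm_big _) -> : perm_eq s [seq x <- t | x \in s].
  apply: uniq_perm; rewrite ?filter_uniq // => x; rewrite mem_filter.
  by case: (boolP (x \in s)) => // /st ->.
by rewrite big_filter big_mkcond /=; apply: ler_sum => x _; case: ifP.
Qed.

Lemma sum_geometric_le (R : realFieldType) (x : R) (a n : nat) : 0 <= x -> x < 1 ->
  \sum_(a <= i < n) x ^+ i <= x ^+ a / (1 - x).
Proof.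
move=> x0 x1; have x1' : 0 < 1 - x by rewrite subr_gt0.
have [na|an] := leqP n a; first by rewrite big_geq // divr_ge0 ?exprn_ge0 // ltW.
rewrite ler_pdivlMr // mulr_suml.
under eq_bigr do rewrite mulrBr mulr1 -exprSr.
rewrite (@telescope_sumr_eq _ a n (fun i => - x ^+ i)) => [||i _]; last 2 first.
- exact: ltnW.
- by rewrite opprK addrC.
by rewrite opprK addrC gerDl oppr_le0 exprn_ge0.
Qed.

Lemma exprn_small (R : archiRealFieldType) (x D e : R) : 0 <= x -> x < 1 -> 0 <= D -> 0 < e ->
  exists n, D * x ^+ n <= e.
Proof.
move=> x0 x1 D0 e0; have y0 : 0 < 1 - x by rewrite subr_gt0.
have bern n : x ^+ n * (1 + n%:R * (1 - x)) <= 1.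
  elim: n => [|n IH]; first by rewrite expr0 mul0r addr0 mulr1.
  apply: le_trans IH; rewrite exprSr -mulrA ler_wpM2l ?exprn_ge0 //.
  rewrite -natr1; have : 0 <= n%:R :> R by []; move: n%:R => k k0.
  have : 0 <= k * ((1 - x) * (1 - x)) by rewrite mulr_ge0 // mulr_ge0 ?ltW.
  have : 0 <= (1 - x) * (1 - x) by rewrite mulr_ge0 ?ltW.
  by nra.
exists (Num.truncn (D / (e * (1 - x)))).+1.
set n := _.+1; have := truncnS_gt (D / (e * (1 - x))); rewrite -/n.
rewrite ltr_pdivrMr ?mulr_gt0 // => h.
have X0 : 0 <= x ^+ n by exact: exprn_ge0.
have := bern n; move: X0 h; move: (x ^+ n) (n%:R : R) => X k X0 h h'.
have : X * D <= X * (k * (e * (1 - x))) by rewrite ler_wpM2l // ltW.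
nra.
Qed.

Lemma nneseries_le_bound (R : realType) (u : nat -> R) (e : R) :
  (forall n, 0 <= u n) -> (forall n, \sum_(0 <= i < n) u i <= e) ->
  (\sum_(0 <= i <oo) (u i)%:E <= e%:E)%E.
Proof.
move=> u0 ue; apply: lime_le; first by apply: is_cvg_nneseries => n _ _; rewrite lee_fin.
by apply: nearW => n; rewrite sumEFin lee_fin.
Qed.

(** The convergence half of the Borel-Cantelli lemma: every point of [N] lies in boxes of
    arbitrarily late stages, so the stages from [i0] on cover [N], with total volume at most
    [D x^i0 / (1 - x)]. *)
Lemma lebesgue_outer_limsup (R : realType) (m n : nat) (N : set 'M[R]_(m, n))
    (k : nat -> nat) (lo hi : nat -> nat -> 'M[R]_(m, n)) (D x : R) :
  (0 < m)%N -> (0 < n)%N -> 0 <= x -> x < 1 ->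
  (forall i l a b, lo i l a b <= hi i l a b) ->
  (forall i, \sum_(l < k i) \prod_a \prod_b (hi i l a b - lo i l a b) <= D * x ^+ i) ->
  (forall M i0, N M -> exists i l, [/\ (i0 <= i)%N, (l < k i)%N
     & forall a b, lo i l a b <= M a b <= hi i l a b]) ->
  lebesgue_outer N = 0%E.
Proof.
move=> m0 n0 x0 x1 lohi vol cover.
pose v i l := \prod_a \prod_b (hi i l a b - lo i l a b).
have v0 i l : 0 <= v i l.
  by apply: prodr_ge0 => a _; apply: prodr_ge0 => b _; rewrite subr_ge0.
have D0 : 0 <= D.
  have := vol 0%N; rewrite expr0 mulr1; apply: le_trans.
  by apply: sumr_ge0 => l _; exact: v0.
apply/eqP; rewrite eq_le; apply/andP; split; last first.
  apply: le_ereal_inf_tmp => _ [[lo' hi'] [/= lohi' _] <-].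
  apply: nneseries_ge0 => t _ _; rewrite lee_fin.
  by apply: prodr_ge0 => a _; apply: prodr_ge0 => b _; rewrite subr_ge0.
apply/lee_addgt0Pr => e e0; rewrite add0e.
have [i0 Hi0] : exists i0, D * (x ^+ i0 / (1 - x)) <= e.
  have D1 : 0 <= D / (1 - x) by rewrite divr_ge0 // subr_ge0 ltW.
  by have [i Hi] := exprn_small x0 x1 D1 e0; exists i; rewrite [_ / _]mulrC mulrA.
pose act (p : nat * nat) := (i0 <= p.1)%N && (p.2 < k p.1)%N.
(* The double family becomes one sequence by decoding [t] as a pair. An index without an active pair
   gets a degenerate box, of volume 0 because [m] and [n] are positive. *)
pose ab t : 'M[R]_(m, n) * 'M[R]_(m, n) :=
  if @pickle_inv (nat * nat)%type t is Some p then
    if act p then (lo p.1 p.2, hi p.1 p.2) else (0, 0) else (0, 0).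
pose ab1 t := (ab t).1. pose ab2 t := (ab t).2.
pose g (p : nat * nat) := if act p then v p.1 p.2 else 0.
have g0 p : 0 <= g p by rewrite /g; case: ifP.
have abE t : \prod_a \prod_b (ab2 t a b - ab1 t a b) =
    if @pickle_inv (nat * nat)%type t is Some p then g p else 0.
  have z : \prod_(a < m) \prod_(b < n) ((0 : 'M[R]_(m, n)) a b - (0 : 'M[R]_(m, n)) a b) = 0.
    case: m n m0 n0 {N lo hi lohi vol cover v v0 ab ab1 ab2 g g0} => [|m] [|n] // _ _.
    by rewrite big_ord_recl big_ord_recl subrr !mul0r.
  rewrite /ab1 /ab2 /ab /g; case: (pickle_inv t) => [p|]; last exact: z.
  by case: ifP => _; [by [] | exact: z].
have S : (\sum_(0 <= t <oo) (\prod_a \prod_b (ab2 t a b - ab1 t a b))%:E <= e%:E)%E.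
  apply: nneseries_le_bound => [t|M].
    by rewrite abE; case: pickle_inv.
  apply: le_trans Hi0; under eq_bigr do rewrite abE.
  pose s := pmap (@pickle_inv (nat * nat)%type) (iota 0 M).
  have us : uniq s by apply: pmap_uniq (iota_uniq _ _) => t; exact: pickle_invK.
  have -> : \sum_(0 <= t < M)
      (if @pickle_inv (nat * nat)%type t is Some p then g p else 0) = \sum_(p <- s) g p.
    rewrite /index_iota subn0 /s; elim: (iota 0 M) => [|t r IH]; first by rewrite !big_nil.
    by rewrite big_cons /= IH; case: pickle_inv => [p|] /=; rewrite ?big_cons ?add0r.
  (* The first [M] indices meet only stages below [I], so the partial sum is at most the sum over
     the complete stages [i0, ..., I - 1]. *)
  pose I := (\max_(p <- s) p.1).+1.
  pose w := [seq (i, l) | i <- index_iota i0 I, l <- iota 0 (k i)].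
  have uw : uniq w.
    apply: allpairs_uniq_dep => [|i _|]; rewrite ?iota_uniq //.
    by move=> [i l] [i' l'] _ _ [-> ->].
  have -> : \sum_(p <- s) g p = \sum_(p <- [seq p <- s | act p]) g p.
    by rewrite big_filter [RHS]big_mkcond; apply: eq_bigr => p _; rewrite /g; case: ifP.
  apply: (@le_trans _ _ (\sum_(p <- w) g p)).
    apply: ler_sum_subseq => //; first exact: filter_uniq.
    move=> [i l]; rewrite mem_filter => /andP[/andP[/= i0i lk] ps].
    apply/allpairsPdep; exists i, l; split => //.
      rewrite mem_index_iota i0i /= ltnS.
      exact: (@leq_bigmax_seq _ s xpredT (fun p : nat * nat => p.1) (i, l) ps).
    by rewrite mem_iota.
  rewrite /w big_allpairs_dep /=.
  apply: (@le_trans _ _ (\sum_(i0 <= i < I) D * x ^+ i)).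
    rewrite big_nat_cond [leRHS]big_nat_cond; apply: ler_sum => i /andP[/andP[ii _] _].
    apply: le_trans (vol i).
    have -> : iota 0 (k i) = index_iota 0 (k i) by rewrite /index_iota subn0.
    rewrite big_mkord.
    by apply: ler_sum => l _; rewrite /g /act /= ii ltn_ord.
  by rewrite -mulr_sumr ler_wpM2l // sum_geometric_le.
apply: le_trans S; apply: ereal_inf_lbound.
exists (ab1, ab2) => //; split => /= [t a b|M NM].
  rewrite /ab1 /ab2 /ab; by case: pickle_inv => [p|] //=; case: ifP => _ /=; rewrite ?lohi.
have [i [l [ii0 lk H]]] := cover M i0 NM.
exists (choice.pickle (i, l)) => // a b.
by rewrite /ab1 /ab2 /ab pickleK_inv /act /= ii0 lk.
Qed.

(** Induction on [K] with [y = sqrt x]: one factor [i + 1] is absorbed by [y^i], the others by a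
    second [y^i]. *)
Lemma poly_le_exp (R : rcfType) (K : nat) (x : R) : 1 < x ->
  exists2 C : R, 0 <= C & forall i, (i.+1)%:R ^+ K <= C * x ^+ i.
Proof.
elim: K x => [|K IH] x x1.
  by exists 1 => // i; rewrite expr0 mul1r exprn_ege1 // ltW.
have x0 : 0 <= x by apply: le_trans (ltW x1).
pose y := Num.sqrt x; have y1 : 1 < y by rewrite -[X in X < _]sqrtr1 ltr_sqrt // (lt_trans _ x1).
have y0 : 0 < y by apply: lt_trans y1.
(* [c] is chosen so that [c (y - 1) >= 1], which carries [i + 1 <= c y^i] from [i] to [i + 1]. *)
have [C C0 HC] := IH y y1; pose c := 1 + (y - 1)^-1.
have c0 : 0 <= c by rewrite addr_ge0 // invr_ge0 subr_ge0 ltW.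
have lin i : (i.+1)%:R <= c * y ^+ i.
  elim: i => [|i IHi]; first by rewrite expr0 mulr1 lerDl invr_ge0 subr_ge0 ltW.
  rewrite -natr1; apply: le_trans (lerD IHi (lexx 1)) _.
  have cy : 1 <= c * (y - 1) by rewrite mulrDl mul1r mulVf ?lerDr ?subr_ge0 ?ltW // subr_eq0 gt_eqF.
  have yi : 1 <= y ^+ i by rewrite exprn_ege1 // ltW.
  rewrite exprS; nra.
exists (C * c) => [|i]; first exact: mulr_ge0.
have -> : x = y * y by rewrite -expr2 sqr_sqrtr.
rewrite exprSr exprMn mulrACA ler_pM // ?exprn_ge0 //.
Qed.

(* Any base in ]1, 2[ would do instead of 3/2: boundary_estimate needs the bound to be
   summable against [2^-i], the extreme case being d = 2. *)
Definition good_discrepancy (R : realType) m d (L : 'M[R]_(m, d)) : Prop :=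
  exists2 C : R, 0 <= C & forall i (t a b : 'I_m -> R),
    (forall j, 0 <= a j) -> (forall j, b j <= 1) ->
    `|box_count L (2 ^ i) t a b - (2 ^ i)%:R ^+ d * box_volume a b|
      <= C * (3 / 2) ^+ i.

Lemma box_volume_itv (R : realType) m (a b : 'I_m -> R) :
  (forall j, 0 <= a j) -> (forall j, b j <= 1) -> 0 <= box_volume a b <= 1.
Proof.
move=> a0 b1; rewrite /box_volume prodr_ge0 /=; last by move=> i _; rewrite le_max lexx.
apply: prodr_ile1 => i _; rewrite le_max lexx /= ge_max ler01 /=.
by have := a0 i; have := b1 i; lra.
Qed.

Lemma box_count_itv (R : realType) m d (L : 'M[R]_(m, d)) N (t a b : 'I_m -> R) :
  0 <= box_count L N t a b <= N%:R ^+ d.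
Proof.
rewrite /box_count sumr_ge0 /=; last by move=> n _; apply: prodr_ge0 => i _.
have -> : N%:R ^+ d = \sum_(n : {ffun 'I_d -> 'I_N}) 1 :> R.
  by rewrite sumr_const card_ffun !card_ord natrX.
apply: ler_sum => n _; apply: prodr_ile1 => i _; rewrite ler0n /=.
by case: (_ <= _ <= _).
Qed.

Lemma trivial_discrepancy (R : realType) m d (L : 'M[R]_(m, d)) N (t a b : 'I_m -> R) :
  (forall j, 0 <= a j) -> (forall j, b j <= 1) ->
  `|box_count L N t a b - N%:R ^+ d * box_volume a b| <= N%:R ^+ d.
Proof.
move=> a0 b1; have /andP[v0 v1] := box_volume_itv a0 b1.
have /andP[c0 c1] := box_count_itv L N t a b.
have N0 : 0 <= N%:R ^+ d :> R by rewrite exprn_ge0.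
by rewrite ler_distl; apply/andP; split; nra.
Qed.

(** With integer parts shifted by [i] into [0..2i], stage [i] has finitely many cells of side
    [1 / q]. They cover all matrices with entries bounded by [i], hence any given matrix from some
    stage on. *)
Lemma cell_exists (R : realType) (q : nat) m d (L : 'M[R]_(m, d)) i : prime q ->
  (forall a b, `|L a b| <= i%:R) ->
  exists (c : 'M['I_(i.*2.+1)]_(m, d)) (A : 'M['F_q]_(m, d)), forall a b,
    (((c a b : nat)%:Z - i%:Z)%:~R + (A a b : nat)%:R / q%:R <= L a b
      <= ((c a b : nat)%:Z - i%:Z)%:~R + ((A a b : nat)%:R + 1) / q%:R).
Proof.
move=> q_pr Li; have q0 : 0 < q%:R :> R by rewrite ltr0n prime_gt0.
exists (\matrix_(a, b) inord (absz (Num.floor (L a b) + i%:Z))).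
exists (\matrix_(a, b) (Num.truncn (q%:R * frac (L a b)))%:R) => a b; rewrite !mxE.
have := Li a b; rewrite ler_norml => /andP[Li1 Li2].
have f0 : 0 <= Num.floor (L a b) + i%:Z.
  by rewrite -lerBlDr sub0r floor_ge_int rmorphN.
have f1 : Num.floor (L a b) + i%:Z <= i.*2%:Z.
  rewrite -lerBrDr -addnn PoszD addrK -ltzD1 floor_lt_int.
  by rewrite intrD1 -pmulrn (le_lt_trans Li2) // ltrDl.
have /andP[r0 r1] := frac_itv (L a b).
rewrite inordK; last first.
  by rewrite ltnS -lez_nat gez0_abs.
rewrite gez0_abs // addrK val_Fp_nat // modn_small; last first.
  by rewrite truncn_lt_nat ?mulr_ge0 // -[ltRHS]mulr1 ltr_pM2l.
have := truncn_itv (mulr_ge0 (ltW q0) r0) => /andP[t1 t2].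
have e : L a b = (Num.floor (L a b))%:~R + frac (L a b) by rewrite /frac subrKC.
move: e t1 t2; move: (frac _) (Num.floor _) => r f -> t1 t2.
rewrite !lerD2l ler_pdivrMr // ler_pdivlMr // [r * _]mulrC t1 /= natr1.
exact: ltW.
Qed.

Section Metric.
Variables (R : realType) (m d : nat) (m_gt0 : (0 < m)%N) (d_gt0 : (0 < d)%N).

(** Markov's inequality for the mean of [fourier_bound] over all matrices. *)
Lemma bad_cells_count (q i r : nat) : prime q -> (q <= 2 ^ r)%N ->
  #|[set A : 'M['F_q]_(m, d) | ((3 / 2) ^+ i < fourier_bound R A)%R]%SET|%:R
    * (3 / 2) ^+ i <= (q ^ (m * d))%:R * (1 + 2 * r%:R) ^+ (m + d) :> R.
Proof.
move=> q_pr qr; apply: le_trans (sum_fourier_bound R q_pr m d qr).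
rewrite mulr_natl -sumr_const.
rewrite [leRHS](bigID (fun A => (3 / 2) ^+ i < fourier_bound R A)) /=.
rewrite -[leLHS]addr0 lerD //; last by apply: sumr_ge0 => A _; exact: fourier_bound_ge0.
rewrite (eq_bigl (fun A => (3 / 2) ^+ i < fourier_bound R A)) => [|A]; last by rewrite inE.
by apply: ler_sum => A /ltW.
Qed.

Lemma metric_discrepancy (P : set 'M[R]_(m, d)) :
  (forall L, good_discrepancy L -> P L) -> almost_all P.
Proof.
move=> goodP; have [q Hq] := choice (fun i => exists_prime_between (i * d.+1)).
have q_pr i : prime (q i) by have [] := Hq i.
have q0 i : 0 < (q i)%:R :> R by rewrite ltr0n prime_gt0.
pose T i : finType := ('M['I_(i.*2.+1)]_(m, d) * 'M['F_(q i)]_(m, d))%type.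
pose bad i := [set A : 'M['F_(q i)]_(m, d) | ((3 / 2) ^+ i < fourier_bound R A)%R]%SET.
pose B i : seq (T i) := enum (finset.setX [set: 'M['I_(i.*2.+1)]_(m, d)] (bad i)).
pose x0 i : T i := (const_mx ord0, 0).
pose lo i l : 'M[R]_(m, d) := \matrix_(a, b)
  ((((nth (x0 i) (B i) l).1 a b : nat)%:Z - i%:Z)%:~R
   + ((nth (x0 i) (B i) l).2 a b : nat)%:R / (q i)%:R).
pose hi i l : 'M[R]_(m, d) := \matrix_(a, b) (lo i l a b + (q i)%:R^-1).
(* [9/8] is the ratio of [3/4] to [2/3]: the bad cells of stage [i] have volume at most a polynomial
   in [i] times [(2/3)^i], and absorbing the polynomial in [(9/8)^i] leaves the summable
   [(3/4)^i]. *)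
have [C0 C0_ge0 HC0] := @poly_le_exp R (m * d + (m + d)) (9 / 8) ltac:(lra).
(* [(8 (d + 1) + 9) (i + 1)] dominates both [2i + 1] and [1 + 2r = 4i (d + 1) + 9]. *)
pose D : R := C0 * (8 * d.+1%:R + 9) ^+ (m * d + (m + d)).
apply: (@lebesgue_outer_limsup R m d _ (fun i => size (B i)) lo hi D (3 / 4)) => //; first lra.
- by move=> i l a b; rewrite [hi _ _ _ _]mxE lerDl invr_ge0 ltW.
- move=> i; set Q : R := (q i)%:R; pose r := ((i * d.+1).*2 + 4)%N.
  have volE l : \prod_a \prod_b (hi i l a b - lo i l a b) = Q ^- (m * d).
    rewrite -exprVn mulnC exprM -[X in _ ^+ X](card_ord m) -prodr_const.
    apply: eq_bigr => a _; rewrite -[X in _ ^+ X](card_ord d) -prodr_const.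
    by apply: eq_bigr => b _; rewrite [hi _ _ _ _]mxE addrAC subrr add0r.
  under eq_bigr do rewrite volE.
  rewrite sumr_const card_ord -[X in X <= _]mulr_natl.
  have -> : size (B i) = (i.*2.+1 ^ (m * d) * #|bad i|)%N.
    by rewrite /B -cardE cardsX cardsT card_mx card_ord.
  have := bad_cells_count i (q_pr i) (_ : (q i <= 2 ^ r)%N).
  have [_ _ qr] := Hq i; move=> /(_ qr); rewrite -/(bad i) natrX -/Q.
  have Qi : 0 < Q ^+ (m * d) by apply: exprn_gt0; exact: q0.
  have Ei : 0 < (3 / 2) ^+ i :> R by rewrite exprn_gt0.
  move=> cnt; rewrite ler_pdivrMr // -(ler_pM2r Ei) natrM -[leLHS]mulrA.
  apply: (@le_trans _ _ ((i.*2.+1 ^ (m * d))%:R * (Q ^+ (m * d) * (1 + 2 * r%:R) ^+ (m + d)))).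
    by rewrite ler_wpM2l.
  have -> : D * (3 / 4) ^+ i * Q ^+ (m * d) * (3 / 2) ^+ i
      = Q ^+ (m * d) * (D * ((3 / 4) ^+ i * (3 / 2) ^+ i)) by ring.
  rewrite [leLHS]mulrCA ler_pM2l //.
  have -> : (3 / 4) ^+ i * (3 / 2) ^+ i = (9 / 8) ^+ i :> R.
    by rewrite -exprMn; congr (_ ^+ _); field.
  rewrite /D [C0 * _]mulrC -mulrA.
  apply: le_trans (ler_wpM2l _ (HC0 i)); last by rewrite exprn_ge0 // addr_ge0 // mulr_ge0.
  rewrite -exprMn [leRHS]exprD natrX; apply: ler_pM; rewrite ?exprn_ge0 ?addr_ge0 ?mulr_ge0 //.
    apply: lerXn2r; rewrite ?nnegrE ?mulr_ge0 ?addr_ge0 ?mulr_ge0 //.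
    rewrite -!(natrM, natrD) ler_nat; nia.
  apply: lerXn2r; rewrite ?nnegrE ?mulr_ge0 ?addr_ge0 ?mulr_ge0 //.
  rewrite -[1]/(1%:R) -!(natrM, natrD) ler_nat /r; nia.
- move=> L i0 /= NL; apply: contrapT => no; apply: NL; apply: goodP.
  have [M HM] : exists M : nat, forall a b, `|L a b| <= M%:R.
    exists (Num.truncn (\sum_a \sum_b `|L a b|)).+1 => a b.
    apply: ltW; apply: le_lt_trans (truncnS_gt _).
    rewrite (bigD1 a) //= (bigD1 b) //= -addrA lerDl addr_ge0 ?sumr_ge0 // => x _.
    by rewrite sumr_ge0.
  (* From [I] on the entries of [L] fit in the stage and its cell is not bad; the finitely many
     earlier stages are paid for by the trivial bound [2^(I d)] in the constant. *)
  pose I := maxn i0 M.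
  exists (1 + m%:R * (d%:R + 3) + (2 ^ I)%:R ^+ d) => [|i t a b a0 b1].
    by rewrite !addr_ge0 ?mulr_ge0 ?exprn_ge0.
  have E1 : 1 <= (3 / 2) ^+ i :> R by rewrite exprn_ege1 //; lra.
  have [iI|Ii] := ltnP i I.
    apply: le_trans (trivial_discrepancy L _ t a0 b1) _.
    apply: (@le_trans _ _ ((2 ^ I)%:R ^+ d)).
      by rewrite lerXn2r ?nnegrE // ler_nat leq_exp2l // ltnW.
    rewrite -[leLHS]mulr1 ler_pM ?exprn_ge0 // lerDr !addr_ge0 ?mulr_ge0 //.
  have LiM x y : `|L x y| <= i%:R.
    by apply: le_trans (HM x y) _; rewrite ler_nat (leq_trans _ Ii) // leq_maxr.
  have [c [A cA]] := cell_exists (q_pr i) LiM.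
  have [Abad|Agood] := boolP (A \in bad i).
    exfalso; apply: no.
    have cAB : (c, A) \in B i by rewrite mem_enum finset.in_setX /= finset.in_setT Abad.
    exists i, (index (c, A) (B i)); split.
    - by rewrite (leq_trans _ Ii) // leq_maxl.
    - by rewrite index_mem.
    - move=> x y; rewrite [hi _ _ _ _]mxE [lo _ _ _ _]mxE nth_index //=.
      by have := cA x y; rewrite mulrDl mul1r addrA.
  have [_ q1 _] := Hq i.
  have Nq : (2 ^ i <= q i)%N.
    by apply: leq_trans (ltnW q1); rewrite leq_exp2l // leq_pmulr.
  have := box_count_discrepancy (q_pr i) Nq (c := \matrix_(x, y) ((c x y : nat)%:Z - i%:Z))
    (A := A) (L := L) _ t a0 b1.
  have h x y : (((\matrix_(x, y) ((c x y : nat)%:Z - i%:Z)) : 'M[int]_(m, d)) x y)%:~R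
     + (A x y : nat)%:R / (q i)%:R <= L x y <=
     (((\matrix_(x, y) ((c x y : nat)%:Z - i%:Z)) : 'M[int]_(m, d)) x y)%:~R
      + ((A x y : nat)%:R + 1) / (q i)%:R by rewrite mxE; exact: cA.
  move=> /(_ h) /le_trans; apply.
  have A1 : fourier_bound R A <= (3 / 2) ^+ i by move: Agood; rewrite inE -leNgt.
  have A2 : (2 ^ i)%:R ^+ d * (m%:R * (((d * 2 ^ i)%N%:R + 3) / (q i)%:R))
      <= m%:R * (d%:R + 3) :> R.
    rewrite mulrCA ler_wpM2l // mulrA ler_pdivrMr //.
    apply: (@le_trans _ _ ((d%:R + 3) * (2 ^ (i * d.+1))%:R)); last first.
      by rewrite ler_wpM2l ?addr_ge0 // ler_nat ltnW.
    rewrite -!(natrX, natrM, natrD) ler_nat -expnM mulnS expnD.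
    have := expn_gt0 2 i; nia.
  have A3 : 0 <= (2 ^ I)%:R ^+ d :> R by rewrite exprn_ge0.
  have A4 : 0 <= m%:R * (d%:R + 3) :> R by rewrite mulr_ge0 // addr_ge0.
  apply: le_trans (lerD A1 A2) _.
  move: E1 A3 A4; move: (_ ^+ i) (_ ^+ d) (m%:R * _) => x y z; nra.
Qed.

End Metric.

(** * Moving averages and the boundary of finite sets *)

(** A discrete measure of the boundary of [X]. For duplicate-free [X] it is subadditive in [v], so
    bounds for unit steps yield bounds for all vectors. *)
Definition exits (V : zmodType) (X : seq V) (v : V) : nat :=
  count (fun x => x + v \notin X) X.

Section Exits.
Variables (V : zmodType) (X : seq V) (uX : uniq X).

Lemma exits0 : exits X 0 = 0%N.
Proof.
apply/eqP; rewrite -leqn0 leqNgt -has_count; apply/hasPn => x xX.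
by rewrite addr0 xX.
Qed.

Lemma exitsD u v : (exits X (u + v) <= exits X u + exits X v)%N.
Proof.
apply: (@leq_trans (exits X u + count (fun x => (x + u \in X) && (x + u + v \notin X)) X)).
  rewrite /exits -count_predUI; apply: leq_trans (leq_addr _ _); apply: sub_count => x /=.
  by rewrite addrA => ->; case: (_ \in X).
rewrite leq_add2l /exits -!size_filter -(size_map (fun x => x + u)).
apply: uniq_leq_size; first by rewrite map_inj_uniq ?filter_uniq //; exact: addIr.
move=> z /mapP[x xin ->]; move: xin; rewrite !mem_filter.
by move=> /andP[/andP[-> ->] _].
Qed.

Lemma exitsMn v n : (exits X (v *+ n) <= n * exits X v)%N.
Proof.
elim: n => [|n IH]; first by rewrite mulr0n exits0.
by rewrite mulrS mulSn (leq_trans (exitsD _ _)) // leq_add2l.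
Qed.

Lemma exits_sum (I : Type) (r : seq I) (v : I -> V) :
  (exits X (\sum_(i <- r) v i) <= \sum_(i <- r) exits X (v i))%N.
Proof.
elim: r => [|i r IH]; first by rewrite !big_nil exits0.
by rewrite !big_cons (leq_trans (exitsD _ _)) // leq_add2l.
Qed.

Lemma exits_opp v : count (fun x => x - v \notin X) X = exits X v.
Proof.
rewrite /exits; apply: (@addnI (count (fun x => x + v \in X) X)).
rewrite (count_predC (fun x => x + v \in X) X).
rewrite -(count_predC (fun x => x - v \in X) X); congr (_ + _)%N.
rewrite -!size_filter -(size_map (fun x => x + v)); apply: perm_size.
apply: uniq_perm; rewrite ?filter_uniq ?map_inj_uniq ?filter_uniq //; first exact: addIr.
move=> y; rewrite mem_filter; apply/mapP/andP => [[x]|[h1 h2]].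
  by rewrite mem_filter => /andP[xv xX] ->; rewrite addrK.
by exists (y - v); rewrite ?subrK // mem_filter subrK h2.
Qed.

(** The terms at points common to [X] and [X + v] cancel; by [exits_opp], [exits X v] terms remain
    on either side. *)
Lemma sum_shift_le (R : numDomainType) (g : V -> R) (B : R) v :
  (forall x, `|g x| <= B) ->
  `|\sum_(x <- X) g x - \sum_(x <- X) g (x + v)| <= 2 * B * (exits X v)%:R.
Proof.
move=> gB.
rewrite (bigID (fun x => x - v \in X)) /= [X in _ - X](bigID (fun x => x + v \in X)) /=.
have -> : \sum_(x <- X | x - v \in X) g x = \sum_(x <- X | x + v \in X) g (x + v).
  rewrite -big_filter -[RHS]big_filter -[RHS](big_map (fun x => x + v) xpredT).
  apply: perm_big; apply: uniq_perm; rewrite ?filter_uniq ?map_inj_uniq ?filter_uniq //.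
    exact: addIr.
  move=> y; rewrite mem_filter; apply/andP/mapP => [[h1 h2]|[x]].
    by exists (y - v); rewrite ?subrK // mem_filter subrK h2.
  by rewrite mem_filter => /andP[xv xX] ->; rewrite addrK.
rewrite opprD addrACA subrr add0r (le_trans (ler_normB _ _)) //.
have bound (P : pred V) (h : V -> R) : (forall x, `|h x| <= B) ->
    `|\sum_(x <- X | P x) h x| <= B * (count P X)%:R.
  move=> hB; apply: le_trans (ler_norm_sum _ _ _) _.
  apply: le_trans (ler_sum _ (fun x _ => hB x)) _.
  by rewrite big_const_seq iter_addr_0 mulr_natr.
rewrite -mulrA mulr2n mulrDl mul1r lerD //; last exact: bound.
by rewrite -(exits_opp v); apply: bound.
Qed.

End Exits.

Definition cube_offset d N (u : {ffun 'I_d -> 'I_N}) : 'cV[int]_d :=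
  \col_j (u j : nat)%:Z.

Definition cube_sum (R : nmodType) d (f : 'cV[int]_d -> R) (N : nat) (x : 'cV[int]_d) : R :=
  \sum_(u : {ffun 'I_d -> 'I_N}) f (x + cube_offset u).

Lemma cube_sum1 (R : nmodType) d (f : 'cV[int]_d -> R) x : cube_sum f 1 x = f x.
Proof.
rewrite /cube_sum (bigD1 [ffun=> ord0]) //= big1 => [|u /eqP []].
  rewrite addr0; congr f; apply/matrixP => i j.
  by rewrite !mxE ffunE addr0.
by apply/ffunP => i; rewrite ord1 [RHS]ord1.
Qed.

Lemma cube_sum_double (R : nmodType) d (f : 'cV[int]_d -> R) N x : (0 < N)%N ->
  cube_sum f (2 * N) x =
  \sum_(e : {ffun 'I_d -> 'I_2}) cube_sum f N (x + cube_offset e *+ N).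
Proof.
move=> N0; rewrite /cube_sum pair_bigA /=.
have hP (p : {ffun 'I_d -> 'I_2} * {ffun 'I_d -> 'I_N}) j :
  (p.1 j * N + p.2 j < 2 * N)%N.
  by have := ltn_ord (p.1 j); have := ltn_ord (p.2 j); nia.
pose h p : {ffun 'I_d -> 'I_(2 * N)} := [ffun j => Ordinal (hP p j)].
have hdiv (u : {ffun 'I_d -> 'I_(2 * N)}) j : (u j %/ N < 2)%N.
  by rewrite ltn_divLR.
have hmod (u : {ffun 'I_d -> 'I_(2 * N)}) j : (u j %% N < N)%N by rewrite ltn_pmod.
rewrite (reindex h) /=; last first.
  exists (fun u => ([ffun j => Ordinal (hdiv u j)], [ffun j => Ordinal (hmod u j)])).
    move=> [e u] _; congr pair; apply/ffunP => j; rewrite !ffunE; apply/val_inj.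
      by rewrite /= ffunE /= divnMDl // divn_small // addn0.
    by rewrite /= ffunE /= modnMDl modn_small.
  move=> u _; apply/ffunP => j; rewrite ffunE; apply/val_inj.
  by rewrite /= !ffunE /= -divn_eq.
apply: eq_bigr => p _; congr f; rewrite -addrA; congr (_ + _).
apply/matrixP => a b; rewrite !mxE ffunE mulmxnE !mxE /=.
by rewrite PoszD PoszM -mulr_natr natz.
Qed.

Definition unit_step d (j : 'I_d) : 'cV[int]_d := delta_mx j 0.

Lemma exits_cube_offset d (X : seq 'cV[int]_d) (e : {ffun 'I_d -> 'I_2}) N : uniq X ->
  (exits X (cube_offset e *+ N) <= N * \sum_j exits X (unit_step j))%N.
Proof.
move=> uX; apply: leq_trans (exitsMn uX _ _) _; rewrite leq_mul2l; apply/orP; right.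
have -> : cube_offset e = \sum_j (unit_step j *+ e j).
  apply/matrixP => a b; rewrite ord1 mxE summxE (bigD1 a) //= mulmxnE mxE !eqxx /=.
  rewrite big1 ?addr0 => [|j ja]; first by rewrite -[LHS]natz.
  by rewrite mulmxnE mxE eq_sym (negPf ja) /= mul0rn.
apply: leq_trans (exits_sum uX _ _) _; apply: leq_sum => j _.
apply: leq_trans (exitsMn uX _ _) _; rewrite -[leqRHS]mul1n leq_mul2r.
by apply/orP; right; have := ltn_ord (e j); rewrite ltnS.
Qed.

Section Flow.
Variables (R : realType) (d : nat) (d_ge2 : (2 <= d)%N) (f : 'cV[int]_d -> R) (C : R).

(** The constant 8 is [2 * 4]: 2 from [sum_shift_le], 4 from the sum of [(3/4)^i], where
    [3/4 = 2 * 3/8] weighs averages of size [(3/8)^i] against translations by [2^i]. *)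
Lemma boundary_estimate (X : seq 'cV[int]_d) : uniq X -> 0 <= C ->
  (forall i x, `|cube_sum f (2 ^ i) x| <= C * (3 / 2) ^+ i) ->
  `|\sum_(x <- X) f x| <= 8 * C * (\sum_j exits X (unit_step j))%:R.
Proof.
move=> uX C0 fC; set O := (\sum_j _)%N.
pose M i x := cube_sum f (2 ^ i) x / (2 ^ (i * d))%:R.
have p0 k : 0 < (2 ^ k)%:R :> R by rewrite ltr0n expn_gt0.
have M_le i x : `|M i x| <= C * (3 / 8) ^+ i.
  rewrite normrM normfV normr_nat ler_pdivrMr //; apply: le_trans (fC i x) _.
  rewrite -mulrA ler_wpM2l //.
  (* [d >= 2] enters here: dividing by [2^(i d) >= 4^i] turns [(3/2)^i] into [(3/8)^i]. *)
  have -> : (3 / 2) ^+ i = (3 / 8) ^+ i * (2 ^ (i * 2))%:R :> R.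
    by rewrite mulnC natrX exprM -exprMn; congr (_ ^+ _); field.
  by rewrite ler_wpM2l ?exprn_ge0 // ler_nat leq_exp2l // leq_mul2l d_ge2 orbT.
pose S i := \sum_(x <- X) M i x.
have step i : `|S i - S i.+1| <= 2 * C * O%:R * (3 / 4) ^+ i.
  have -> : S i - S i.+1 = \sum_(e : {ffun 'I_d -> 'I_2})
      (\sum_(x <- X) M i x - \sum_(x <- X) M i (x + cube_offset e *+ 2 ^ i)) / (2 ^ d)%:R.
    rewrite -mulr_suml sumrB sumr_const card_ffun !card_ord -[X in _ = (X - _) / _]mulr_natr.
    rewrite mulrBl mulfK ?gt_eqF //; congr (_ - _).
    rewrite exchange_big mulr_suml; apply: eq_bigr => x _.
    rewrite /M expnS cube_sum_double ?expn_gt0 // -mulr_suml -mulrA; congr (_ * _).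
    by rewrite mulSn expnD natrM invfM mulrC.
  apply: le_trans (ler_norm_sum _ _ _) _.
  apply: (@le_trans _ _ (\sum_(e : {ffun 'I_d -> 'I_2})
      2 * C * O%:R * (3 / 4) ^+ i / (2 ^ d)%:R)).
    apply: ler_sum => e _; rewrite normrM normfV normr_nat ler_pM2r ?invr_gt0 //.
    apply: le_trans (sum_shift_le uX (cube_offset e *+ 2 ^ i) (M_le i)) _.
    apply: (@le_trans _ _ (2 * (C * (3 / 8) ^+ i) * (2 ^ i * O)%N%:R)).
      by rewrite ler_wpM2l ?mulr_ge0 ?exprn_ge0 // ler_nat exits_cube_offset.
    have -> : (3 / 4) ^+ i = (3 / 8) ^+ i * (2 ^ i)%:R :> R.
      by rewrite natrX -exprMn; congr (_ ^+ _); field.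
    by rewrite natrM le_eqVlt; apply/orP; left; apply/eqP; ring.
  by rewrite sumr_const card_ffun !card_ord -[leLHS]mulr_natr divfK ?gt_eqF.
have tele I : `|S 0%N - S I| <= 8 * C * O%:R.
  have -> : S 0%N - S I = \sum_(0 <= i < I) (S i - S i.+1).
    by rewrite (@telescope_sumr_eq _ 0 I (fun i => - S i)) // => [|i _]; rewrite opprK addrC.
  apply: le_trans (ler_norm_sum _ _ _) _; apply: le_trans (ler_sum _ (fun i _ => step i)) _.
  rewrite -mulr_sumr; have h : \sum_(0 <= i < I) (3 / 4) ^+ i <= 4 :> R.
    have := @sum_geometric_le R (3 / 4) 0 I ltac:(lra) ltac:(lra); rewrite expr0 mul1r.
    by have -> : (1 - 3 / 4)^-1 = 4 :> R by field.
  apply: le_trans (ler_wpM2l _ h) _; first by rewrite !mulr_ge0.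
  by rewrite le_eqVlt; apply/orP; left; apply/eqP; ring.
have S0 : S 0%N = \sum_(x <- X) f x.
  by apply: eq_bigr => x _; rewrite /M mul0n expn0 divr1 cube_sum1.
rewrite -S0; apply/ler_addgt0Pr => e e0.
(* [S I] is at most [|X| C (3/8)^I], which tends to 0, whereas the telescoping bound does not depend
   on [I]. *)
have [I HI] := @exprn_small R (3 / 8) ((size X)%:R * C) e ltac:(lra) ltac:(lra)
  (mulr_ge0 (ler0n _ _) C0) e0.
have SI : `|S I| <= e.
  apply: le_trans HI; apply: le_trans (ler_norm_sum _ _ _) _.
  apply: le_trans (ler_sum _ (fun x _ => M_le I x)) _.
  by rewrite big_const_seq count_predT iter_addr_0 -[leLHS]mulr_natl mulrA.
rewrite -[S 0%N](subrK (S I)); apply: le_trans (ler_normD _ _) _.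
exact: lerD.
Qed.

End Flow.

(** * The Hausdorff measure of the boundary of a cube complex *)

Definition int_vector (R : pzRingType) d (x : 'cV[int]_d) : 'cV[R]_d := map_mx intr x.

Definition int_vectors (R : pzRingType) d (X : seq 'cV[int]_d) : set 'cV[R]_d :=
  [set int_vector R x | x in [set` X]].

Arguments int_vectors R {d} X.

Lemma cube_complexP (R : realType) d (X : seq 'cV[int]_d) (v : 'cV[R]_d) :
  cube_complex (int_vectors R X) v <->
  exists2 x, x \in X & forall i, `|v i 0 - (x i 0)%:~R| <= 2^-1.
Proof.
split=> [[_ [x /= xX <-] [u /= hu <-]]|[x xX hx]].
  by exists x => // i; rewrite !mxE addrK ler_norml hu.
exists (int_vector R x); first by exists x.
exists (v - int_vector R x); rewrite ?subrK // => i.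
by have := hx i; rewrite !mxE ler_norml.
Qed.

(* Faces are shrunk so that distinct ones have distinct points. *)
Definition inner_face (R : realType) d (j : 'I_d) (x : 'cV[int]_d) : set 'cV[R]_d :=
  [set v | v j 0 = (x j 0)%:~R + 2^-1 /\
           forall i, i != j -> `|v i 0 - (x i 0)%:~R| <= 4^-1].

(** Just beyond the face, only the cube centred at [x + unit_step j] could contain [v + s e_j]: the
    other coordinates are within [1/4] of those of [x], and the [j]-th is slightly above
    [x j + 1/2]. As that centre is not in [X], points outside the complex come arbitrarily close to
    [v]. *)
Lemma inner_face_boundary (R : realType) d (X : seq 'cV[int]_d) (j : 'I_d) x :
  x \in X -> x + unit_step j \notin X ->
  @inner_face R d j x `<=` boundary (cube_complex (int_vectors R X)).
Proof.
move=> xX xjX v [vj vi]; split.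
  apply: subset_closure; apply/cube_complexP; exists x => // i.
  have [->|ij] := eqVneq i j; first by rewrite vj addrAC subrr add0r ger0_norm // invr_ge0.
  by apply: le_trans (vi i ij) _; lra.
move=> /nbhs_ballP[e /= e0 He].
pose s := Num.min (e / 2) 8^-1; have s0 : 0 < s by rewrite lt_min; apply/andP; split; lra.
have s1 : s < e by rewrite gt_min; apply/orP; left; lra.
have s2 : s <= 8^-1 by rewrite ge_min lexx orbT.
pose w : 'cV[R]_d := v + s *: delta_mx j 0.
have wE i : w i 0 = v i 0 + s *+ (i == j) by rewrite !mxE eqxx andbT mulr_natr.
have : ball v e w.
  split=> // a b; rewrite ord1 /ball /= wE opprD addrA subrr sub0r normrN.
  by case: eqP => _; rewrite ?mulr1n ?mulr0n ?normr0 ?gtr0_norm.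
move=> /He/cube_complexP[y yX hy]; move: xjX; apply/negP; rewrite negbK.
have -> : x + unit_step j = y; last by [].
apply/matrixP => i k; rewrite ord1 !mxE eqxx andbT.
have := hy i; rewrite wE ler_norml => /andP[h1 h2].
have [ij|ij] := eqVneq i j; rewrite ?ij in h1 h2 *.
  move: h1 h2; rewrite eqxx mulr1n vj => h1 h2.
  have h3 : ((x j 0 + 1)%:~R : R) < (y j 0 + 1)%:~R by rewrite !intrD1; lra.
  have h4 : ((y j 0)%:~R : R) < (x j 0 + 1 + 1)%:~R by rewrite !intrD1; lra.
  by move: h3 h4; rewrite !ltr_int /=; lia.
move: h1 h2; have := vi i ij; rewrite ler_norml (negPf ij) mulr0n addr0 => /andP[h3 h4] h1 h2.
have h5 : ((x i 0)%:~R : R) < (y i 0 + 1)%:~R by rewrite intrD1; lra.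
have h6 : ((y i 0)%:~R : R) < (x i 0 + 1)%:~R by rewrite intrD1; lra.
by move: h5 h6; rewrite !ltr_int /= addr0; lia.
Qed.

Lemma inner_face_compact (R : realType) d (j : 'I_d) x : compact (@inner_face R d j x).
Proof.
pose lo i : R := (x i 0)%:~R + (if i == j then 2^-1 else - 4^-1).
pose hi i : R := (x i 0)%:~R + (if i == j then 2^-1 else 4^-1).
have -> : @inner_face R d j x =
    trmx @` [set v : 'rV[R]_d | forall i, `[lo i, hi i]%classic (v ord0 i)].
  apply/seteqP; split => [v [vj vi]|_ [v /= hv <-]].
    exists v^T; rewrite ?trmxK // => i /=; rewrite mxE in_itv /= /lo /hi.
    have [->|ij] := eqVneq i j; first by rewrite vj !lexx.
    by have := vi i ij; rewrite ler_norml; lra.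
  split=> [|i ij]; rewrite mxE.
    have := hv j; rewrite /= in_itv /= /lo /hi eqxx => /andP[h1 h2].
    by apply/eqP; rewrite eq_le h1 h2.
  have := hv i; rewrite /= in_itv /= /lo /hi (negPf ij) => /andP[h1 h2].
  by rewrite ler_norml; apply/andP; split; lra.
apply: continuous_compact; last first.
  exact: (@rV_compact R d (fun i => `[lo i, hi i]%classic) (fun i => @segment_compact _ _ _)).
apply: continuous_subspaceT => v A /nbhs_ballP[e /= e0 He].
apply/nbhs_ballP; exists e => //= w [_ vw]; apply: He; split=> // a b.
by rewrite !mxE; exact: vw.
Qed.

Lemma euclid_unique (M : nat) (z z' : int) (g g' : nat) : (g < M)%N -> (g' < M)%N ->
  (2 * M)%N%:Z * z + g%:Z = (2 * M)%N%:Z * z' + g'%:Z -> z = z' /\ g = g'.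
Proof.
move=> h h' e; have zz' : z = z'.
  have Mz : 0 < (2 * M)%N%:Z by lia.
  apply/eqP; rewrite eq_le !leNgt; apply/andP; split; apply/negP => lt.
    have : (2 * M)%N%:Z * (z' + 1) <= (2 * M)%N%:Z * z by rewrite ler_pM2l //; lia.
    by rewrite mulrDr; lia.
  have : (2 * M)%N%:Z * (z + 1) <= (2 * M)%N%:Z * z' by rewrite ler_pM2l //; lia.
  by rewrite mulrDr; lia.
by split=> //; move: e; rewrite zz'; lia.
Qed.

(** * Grid points in the inner faces *)

Section Count.
Variables (R : realType) (p : nat) (j : 'I_p.+1).
Local Notation V := 'cV[R]_p.+1.

(** Whatever the face, tangential coordinates lie in the same translate of the lattice of mesh
    [1 / (2M)], with [M^p] points per face. One covering set can thus be tested against all faces at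
    once. *)
Definition face_point (M : nat) (x : 'cV[int]_p.+1) (g : {ffun 'I_p -> 'I_M}) : V :=
  \col_i (if unlift j i is Some i' then
            (x i 0)%:~R - 4^-1 + (g i' : nat)%:R / (2 * M%:R)
          else (x j 0)%:~R + 2^-1).

Lemma face_point_j M x (g : {ffun 'I_p -> 'I_M}) :
  face_point x g j 0 = (x j 0)%:~R + 2^-1.
Proof. by rewrite mxE unlift_none. Qed.

Lemma face_point_lift M x (g : {ffun 'I_p -> 'I_M}) i :
  face_point x g (lift j i) 0
  = (x (lift j i) 0)%:~R - 4^-1 + (g i : nat)%:R / (2 * M%:R).
Proof. by rewrite mxE liftK. Qed.

Lemma face_point_in M x (g : {ffun 'I_p -> 'I_M}) : inner_face j x (face_point x g).
Proof.
split=> [|i ij]; first exact: face_point_j.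
have [i' ->|e] := unliftP j i; last by rewrite e eqxx in ij.
rewrite face_point_lift; have gM := ltn_ord (g i').
have M0 : 0 < M%:R :> R by rewrite ltr0n; lia.
have g1 : (g i' : nat)%:R / (2 * M%:R) <= 2^-1 :> R.
  rewrite ler_pdivrMr ?mulr_gt0 // mulKf // ler_nat; exact: ltnW.
have g0 : 0 <= (g i' : nat)%:R / (2 * M%:R) :> R by rewrite divr_ge0 // mulr_ge0.
by rewrite ler_norml; apply/andP; split; lra.
Qed.

(** In units of the mesh, tangential coordinates of grid points in [U] differ from those of a fixed
    one by at most [w = floor(2 M D)], leaving [2w + 1] values each. They determine the point:
    normal coordinates lie in [Z + 1/2], so [D < 1] forces them to agree. *)
Lemma face_point_count (xs : seq 'cV[int]_p.+1) (M : nat) (U : set V) (D : R) :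
  uniq xs -> (0 < M)%N -> 0 <= D -> D < 1 ->
  (forall v w, U v -> U w -> forall i, `|v i 0 - w i 0| <= D) ->
  (#|[set kg : 'I_(size xs) * {ffun 'I_p -> 'I_M}
      | `[< U (face_point (nth 0 xs kg.1) kg.2) >] ]%SET|)%:R <= (4 * M%:R * D + 1) ^+ p.
Proof.
move=> uxs M0 D0 D1 UD; set S := [set _ | _]%SET.
have MR : 0 < M%:R :> R by rewrite ltr0n.
have [->|[kg0]] := set_0Vmem S.
  by rewrite cards0 exprn_ge0 // addr_ge0 // !mulr_ge0.
rewrite inE => /asboolP U0.
pose w := Num.truncn (2 * M%:R * D).
have wD : w%:R <= 2 * M%:R * D by rewrite truncn_le !mulr_ge0.
pose G (kg : 'I_(size xs) * {ffun 'I_p -> 'I_M}) i : int :=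
  (2 * M)%N%:Z * (nth 0 xs kg.1) (lift j i) 0 + (kg.2 i : nat)%:Z.
have GD kg i : kg \in S -> `|G kg i - G kg0 i| <= w%:Z.
  rewrite inE => /asboolP U1; have := UD _ _ U1 U0 (lift j i).
  have -> : face_point (nth 0 xs kg.1) kg.2 (lift j i) 0 -
      face_point (nth 0 xs kg0.1) kg0.2 (lift j i) 0
      = (G kg i - G kg0 i)%:~R / (2 * M%:R).
    rewrite !face_point_lift /G !(rmorphB, rmorphD, rmorphM) /= -!pmulrn.
    by field; rewrite gt_eqF.
  rewrite normrM normfV [X in _ / X]ger0_norm ?mulr_ge0 // ler_pdivrMr ?mulr_gt0 //.
  rewrite -intr_norm mulrC => h.
  by rewrite -abszE lez_nat truncn_ge_nat ?mulr_ge0 // pmulrn abszE.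
pose phi kg : {ffun 'I_p -> 'I_(w + w).+1} := [ffun i => inord (absz (G kg i - G kg0 i + w%:Z))].
have phi_inj : {in S &, injective phi}.
  move=> kg kg' kS k'S /ffunP phiE.
  have GE i : G kg i = G kg' i.
    have := GD _ i kS; have := GD _ i k'S; have /(congr1 val) := phiE i.
    rewrite !ffunE /= => e; rewrite !ler_norml => /andP[a1 a2] /andP[b1 b2].
    by move: e; rewrite !inordK; lia.
  have coord i : nth 0 xs kg.1 (lift j i) 0 = nth 0 xs kg'.1 (lift j i) 0 /\
      kg.2 i = kg'.2 i.
    by have [-> /val_inj ->] := euclid_unique (ltn_ord _) (ltn_ord _) (GE i).
  move: kS k'S; rewrite inE => /asboolP U1; rewrite inE => /asboolP U2.
  have := UD _ _ U1 U2 j; rewrite !face_point_j opprD addrACA subrr addr0 => h.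
  have xj : nth 0 xs kg.1 j 0 = nth 0 xs kg'.1 j 0.
    move: h; move: (nth 0 xs kg.1 _ _) (nth 0 xs kg'.1 _ _) => z z'.
    rewrite ler_norml => /andP[h1 h2].
    have h3 : (z%:~R : R) < (z' + 1)%:~R by rewrite intrD1; lra.
    have h4 : (z'%:~R : R) < (z + 1)%:~R by rewrite intrD1; lra.
    by move: h3 h4; rewrite !ltr_int; lia.
  have e1 : kg.1 = kg'.1.
    apply/eqP; rewrite -(inj_eq val_inj) /= -(nth_uniq 0 _ _ uxs) ?ltn_ord //.
    apply/eqP/matrixP => a b; rewrite ord1.
    by have [i ->|->] := unliftP j a; [case: (coord i) | exact: xj].
  have e2 : kg.2 = kg'.2 by apply/ffunP => i; case: (coord i).
  by case: kg kg' e1 e2 {phiE GE coord U1 U2 h xj} => [? ?] [? ?] /= -> ->.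
rewrite -(card_in_imset phi_inj).
apply: (@le_trans _ _ (((w + w).+1 ^ p)%N%:R)).
  rewrite ler_nat; apply: leq_trans (max_card _) _.
  by rewrite card_ffun !card_ord.
rewrite natrX lerXn2r ?nnegrE ?addr_ge0 ?mulr_ge0 // -natr1 natrD; lra.
Qed.

End Count.

Lemma coord_le_euclid (R : realType) n (v : 'cV[R]_n) i : `|v i 0| <= euclid_norm v.
Proof.
rewrite -sqrtr_sqr /euclid_norm ler_sqrt ?sumr_ge0 // => [|k _]; last exact: sqr_ge0.
by rewrite (bigD1 i) //= lerDl sumr_ge0 // => k _; exact: sqr_ge0.
Qed.

Section Diam.
Variables (R : realType) (n : nat) (U : set 'cV[R]_n) (delta : R).
Hypothesis U_delta : forall x y, U x -> U y -> euclid_norm (x - y) <= delta.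

Lemma euclid_le_diam x y : U x -> U y -> euclid_norm (x - y) <= diam U.
Proof.
move=> Ux Uy; apply: sup_ubound; last by exists x => //; exists y.
by exists delta => _ [a Ua [b Ub <-]]; exact: U_delta.
Qed.

Lemma diam_ge0 : 0 <= diam U.
Proof.
have [[x Ux]|U0] := pselect (exists x, U x).
  by apply: le_trans (euclid_le_diam Ux Ux); exact: sqrtr_ge0.
rewrite /diam (_ : [set _ | _ in _ & _ in _] = set0) ?sup0 //.
by apply/seteqP; split => // z [x Ux _]; apply: U0; exists x.
Qed.

Lemma diam_le : 0 <= delta -> diam U <= delta.
Proof.
move=> d0; have [[x Ux]|U0] := pselect (exists x, U x).
  apply: ge_sup; first by exists (euclid_norm (x - x)), x => //; exists x.
  by move=> _ [a Ua [b Ub <-]]; exact: U_delta.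
rewrite /diam (_ : [set _ | _ in _ & _ in _] = set0) ?sup0 //.
by apply/seteqP; split => // z [x Ux _]; apply: U0; exists x.
Qed.

End Diam.

(** The sets of a Hausdorff cover are arbitrary; this open enlargement makes compactness
    available. *)
Definition fatten (R : realType) n (U : set 'cV[R]_n) (h : R) : set 'cV[R]_n :=
  \bigcup_(u in U) (ball u h)°.

Lemma fattenP (R : realType) n (U : set 'cV[R]_n) h v : fatten U h v ->
  exists2 u, U u & forall i, `|u i 0 - v i 0| <= h.
Proof.
move=> [u Uu /interior_subset [_ uv]]; exists u => // i.
by apply: ltW; exact: uv.
Qed.

Lemma compact_finite_cover (R : realType) n (A : set 'cV[R]_n) (V : nat -> set 'cV[R]_n) :
  compact A -> (forall t, open (V t)) -> A `<=` \bigcup_t V t ->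
  exists N, A `<=` \bigcup_(t in `I_N) V t.
Proof.
rewrite compact_cover => /(_ nat setT V) cA oV AV.
have [D _ AD] : finite_subset_cover setT V A by apply: cA => // t _; exact: oV.
exists (\max_(t <- D) t).+1 => v /AD [t /= tD Vt]; exists t => //=.
by rewrite ltnS; apply: (@leq_bigmax_seq _ (enum_fset D) xpredT id t tD).
Qed.

Lemma exprD_le (R : realDomainType) (a b : R) p : 0 <= a -> 0 <= b ->
  (a + b) ^+ p <= 2 ^+ p * (a ^+ p + b ^+ p).
Proof.
move=> a0 b0; have [ab|ba] := leP a b.
  apply: (@le_trans _ _ ((2 * b) ^+ p)).
    by rewrite lerXn2r ?nnegrE ?addr_ge0 ?mulr_ge0 //; lra.
  by rewrite exprMn ler_wpM2l ?exprn_ge0 // lerDr exprn_ge0.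
apply: (@le_trans _ _ ((2 * a) ^+ p)).
  by rewrite lerXn2r ?nnegrE ?addr_ge0 ?mulr_ge0 //; lra.
by rewrite exprMn ler_wpM2l ?exprn_ge0 // lerDl exprn_ge0.
Qed.

Section Cover.
Variables (R : realType) (p : nat) (j : 'I_p.+1) (p_gt0 : (0 < p)%N).
Variables (X : seq 'cV[int]_p.+1) (uX : uniq X).
Variable U : nat -> set 'cV[R]_p.+1.

(* By compactness finitely many of the sets, slightly fattened, cover the inner faces;
   count the points that they contain on a grid of mesh [1 / (2 M)] in these faces. *)
Lemma cover_lower_bound :
  (forall t x y, U t x -> U t y -> euclid_norm (x - y) <= 4^-1) ->
  boundary (cube_complex (int_vectors R X)) `<=` \bigcup_t U t ->
  ((exits X (unit_step j))%:R%:E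
    <= (8 ^+ p)%:E * \sum_(0 <= t <oo) (diam (U t) ^+ p)%:E)%E.
Proof.
move=> U4 XU; apply/lee_addgt0Pr => e e0.
have diam0 t : 0 <= diam (U t) := diam_ge0 (U4 t).
have diam4 t : diam (U t) <= 4^-1 by apply: (diam_le (U4 t)); lra.
(* The [t]-th set is fattened by [h0 / 2^t], at most [2 h0] in total; this [h0] keeps the resulting
   error [24^p 2 h0] below [e]. *)
pose h0 : R := Num.min 8^-1 (e / (2 * 24 ^+ p)).
have h00 : 0 < h0 by rewrite /h0 lt_min divr_gt0 ?mulr_gt0 ?exprn_gt0 // andbT invr_gt0.
have h08 : h0 <= 8^-1 by rewrite /h0 ge_min lexx.
have h0e : 24 ^+ p * (2 * h0) <= e.
  have -> : 24 ^+ p * (2 * h0) = h0 * (2 * 24 ^+ p) by ring.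
  rewrite -ler_pdivlMr ?mulr_gt0 ?exprn_gt0 //.
  by rewrite /h0 ge_min lexx orbT.
pose h t : R := h0 * 2^-1 ^+ t.
have hp t : 0 < h t by rewrite mulr_gt0 ?exprn_gt0 // invr_gt0.
have hle t : h t <= 8^-1.
  by apply: le_trans h08; rewrite ler_piMr ?(ltW h00) // exprn_ile1 ?invr_ge0 //; lra.
pose V t := fatten (U t) (h t).
have oV t : open (V t) by apply: bigcup_open => u _; exact: open_interior.
have UV : \bigcup_t U t `<=` \bigcup_t V t.
  move=> v [t _ Uv]; exists t => //; exists v => //.
  exact: nbhsx_ballx.
pose xs := [seq x <- X | x + unit_step j \notin X].
have [N HN] : exists N, forall x, x \in xs ->
    inner_face j x `<=` \bigcup_(t in `I_N) V t.
  have : forall x, x \in xs -> exists N, @inner_face R _ j x `<=` \bigcup_(t in `I_N) V t.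
    move=> x; rewrite mem_filter => /andP[x1 x2].
    apply: compact_finite_cover => //; first exact: inner_face_compact.
    by apply: subset_trans UV; apply: subset_trans XU; exact: inner_face_boundary.
  elim: (xs) => [|x s IH] H; first by exists 0%N.
  have [x' x's|N1 H1] := IH; first by apply: H; rewrite inE x's orbT.
  have [N2 H2] := H x (mem_head _ _).
  exists (maxn N1 N2) => x'; rewrite inE => /orP[/eqP ->|/H1] => [|{}H1].
    by apply: subset_trans H2 _ => v [t /= tN Vt]; exists t => //=; rewrite leq_max tN orbT.
  by apply: subset_trans H1 _ => v [t /= tN Vt]; exists t => //=; rewrite leq_max tN.
(* The mesh is so fine that the [+ 1] of the count, divided by [M], is at most [4 h t] for every
   [t < N]. *)
pose M := (Num.truncn (4 * h N)^-1).+1.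
have M0 : 0 < M%:R :> R by [].
have hM t : (t < N)%N -> M%:R^-1 <= 4 * h t.
  move=> tN; apply: (@le_trans _ _ (4 * h N)).
    rewrite -[leRHS]invrK lef_pV2 ?posrE ?invr_gt0 ?mulr_gt0 //.
    by apply: ltW; exact: truncnS_gt.
  by rewrite !ler_wpM2l ?(ltW h00) // ler_wiXn2l ?invr_ge0 ?invf_le1 ?ler1n // ltnW.
pose D t := diam (U t) + 2 * h t.
have D0 t : 0 <= D t by rewrite addr_ge0 // mulr_ge0 // ltW.
have D1 t : D t < 1 by have := diam4 t; have := hle t; rewrite /D; lra.
have VD t v w : V t v -> V t w -> forall i, `|v i 0 - w i 0| <= D t.
  move=> /fattenP[a Ua av] /fattenP[b Ub bw] i.
  have := euclid_le_diam (U4 t) Ua Ub; have := coord_le_euclid (a - b) i; rewrite !mxE.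
  have := av i; have := bw i; rewrite /D.
  rewrite !ler_norml; move: (a i 0) (b i 0) (v i 0) (w i 0) => a' b' v' w'.
  move=> /andP[b1 b2] /andP[a1 a2]; move: (euclid_norm _) => E /andP[c1 c2] bE.
  by apply/andP; split; lra.
pose S t := [set kg : 'I_(size xs) * {ffun 'I_p -> 'I_M}
      | `[< V t (face_point R j (nth 0 xs kg.1) kg.2) >] ]%SET.
have cnt t : #|S t|%:R <= (4 * M%:R * D t + 1) ^+ p.
  apply: face_point_count => //; first exact: filter_uniq.
  exact: VD.
have tot : (size xs * M ^ p <= \sum_(t < N) #|S t|)%N.
  have -> : (size xs * M ^ p = \sum_(kg : 'I_(size xs) * {ffun 'I_p -> 'I_M}) 1)%N.
    by rewrite sum1_card card_prod card_ffun !card_ord.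
  have SE t : #|S t| = (\sum_kg (kg \in S t))%N.
    by rewrite -sum1_card big_mkcond; apply: eq_bigr => kg _; case: (kg \in S t).
  under [leqRHS]eq_bigr do rewrite SE.
  rewrite exchange_big /=; apply: leq_sum => kg _.
  have [t /= tN Vt] := HN _ (mem_nth 0 (ltn_ord kg.1)) _ (face_point_in R j _ kg.2).
  rewrite (bigD1 (Ordinal tN)) //= (_ : kg \in S t) // inE.
  exact/asboolP.
have h_sum : \sum_(0 <= t < N) h t <= 2 * h0.
  rewrite -mulr_sumr mulrC ler_wpM2r ?(ltW h00) //.
  have := @sum_geometric_le R 2^-1 0 N ltac:(lra) ltac:(lra); rewrite expr0 mul1r.
  by have -> : (1 - 2^-1)^-1 = 2 :> R by field.
(* After division by [M] the base of the power is at most [4 (diam + 2h) + 4h = 4 diam + 12h].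
   Splitting the power costs [2^p], whence [8^p] and [24^p]; and [h^p <= h] since [p > 0]. *)
have term t : (t < N)%N ->
    #|S t|%:R / M%:R ^+ p <= 8 ^+ p * diam (U t) ^+ p + 24 ^+ p * h t :> R.
  move=> tN; apply: (@le_trans _ _ ((4 * diam (U t) + 12 * h t) ^+ p)).
    rewrite ler_pdivrMr ?exprn_gt0 // -exprMn; apply: le_trans (cnt t) _.
    have hM' : 4 * M%:R * D t + 1 <= (4 * diam (U t) + 12 * h t) * M%:R.
      have := hM t tN; rewrite -(ler_pM2r M0) mulVf ?gt_eqF // => h1.
      by rewrite /D; move: h1; rewrite !(mulrDl, mulrDr); lra.
    have p0 : 0 <= 4 * M%:R * D t + 1 by rewrite addr_ge0 ?mulr_ge0.
    by apply: lerXn2r => //; rewrite nnegrE (le_trans p0).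
  have a0 : 0 <= 4 * diam (U t) by rewrite mulr_ge0.
  have b0 : 0 <= 12 * h t by rewrite mulr_ge0 // (ltW (hp t)).
  apply: le_trans (exprD_le p a0 b0) _.
  have -> : 2 ^+ p * ((4 * diam (U t)) ^+ p + (12 * h t) ^+ p)
      = 8 ^+ p * diam (U t) ^+ p + 24 ^+ p * h t ^+ p.
    by rewrite mulrDr -!exprMn; congr (_ ^+ _ + _ ^+ _); ring.
  rewrite lerD2l ler_wpM2l ?exprn_ge0 //.
  rewrite -[leRHS]expr1 ler_wiXn2l ?(ltW (hp t)) //.
  by apply: le_trans (hle t) _; lra.
have fin : (size xs)%:R <= 8 ^+ p * \sum_(0 <= t < N) diam (U t) ^+ p + e :> R.
  apply: (@le_trans _ _ (\sum_(t < N) (#|S t|%:R / M%:R ^+ p))).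
    rewrite -mulr_suml ler_pdivlMr ?exprn_gt0 // -natrX -natrM -natr_sum ler_nat //.
  apply: (@le_trans _ _ (\sum_(t < N) (8 ^+ p * diam (U t) ^+ p + 24 ^+ p * h t))).
    by apply: ler_sum => t _; exact: term.
  rewrite big_split /= -2!mulr_sumr !big_mkord lerD2l; apply: le_trans h0e.
  by rewrite ler_wpM2l ?exprn_ge0 //; move: h_sum; rewrite big_mkord.
rewrite /exits -size_filter -/xs.
apply: (@le_trans _ _ ((8 ^+ p)%:E * (\sum_(0 <= t < N) diam (U t) ^+ p)%:E + e%:E)%E).
  by rewrite -EFinM -EFinD lee_fin.
rewrite leeD2r // lee_pmul2l ?lte_fin ?exprn_gt0 // -sumEFin.
by apply: nneseries_lim_ge => t _ _; rewrite lee_fin exprn_ge0.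
Qed.

End Cover.

Lemma ball_volume_gt0 (R : realType) p : 0 < ball_volume p :> R.
Proof.
have [n np] := ubnP p; elim: n p np => // n IH [|[|p]] /= np; rewrite ?ltr01 ?ltr0n //.
rewrite mulr_gt0 ?IH //; first by rewrite divr_gt0 // mulr_gt0 // pi_gt0.
by move: np; lia.
Qed.

(** The Hausdorff measure is a supremum over scales, so covers of scale [1/4] already bound it from
    below; [k] is its normalising factor. *)
Lemma exits_le_hausdorff (R : realType) (d : nat) : (1 < d)%N ->
  exists2 c : R, 0 < c & forall (X : seq 'cV[int]_d) j, uniq X ->
    ((exits X (unit_step j))%:R%:E
      <= c%:E * hausdorff d.-1 (boundary (cube_complex (int_vectors R X))))%E.
Proof.
case: d => [|[|p]] // _; set q := p.+1.
pose k : R := ball_volume q / 2 ^+ q.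
have k0 : 0 < k by rewrite divr_gt0 ?ball_volume_gt0 ?exprn_gt0.
exists (8 ^+ q / k) => [|X j uX]; first by rewrite divr_gt0 ?exprn_gt0.
rewrite /hausdorff /= -/k; set A := boundary _.
rewrite muleA -EFinM divfK ?gt_eqF //.
have c0 : 0 < 8 ^+ q :> R by rewrite exprn_gt0.
have h : ((8 ^+ q)^-1%:E * (exits X (unit_step j))%:R%:E <= hausdorff_pre q 4^-1 A)%E.
  apply: le_ereal_inf_tmp => _ [U [U4 AU] <-].
  rewrite lee_pdivrMl //; exact: cover_lower_bound.
rewrite -lee_pdivrMl //; apply: le_trans h _.
by apply: ereal_sup_ubound; exists 4^-1 => //=; rewrite invr_gt0.
Qed.

(** * Cut and project sets as orbits on the torus *)

Section Geometry.
Context {R : realType} {d m : nat}.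
Local Notation V := 'cV[R]_(d + m).
Variable L : 'M[R]_(m, d).

(** The coordinate transversal to [E]: its kernel is [phys L], so it identifies [R^k / E] with
    [R^m], whichever internal space is chosen. *)
Definition star (v : V) : 'cV[R]_m := dsubmx v - L *m usubmx v.

Lemma starD u v : star (u + v) = star u + star v.
Proof. by rewrite /star [dsubmx _]linearD [usubmx _]linearD mulmxDr opprD addrACA. Qed.

Lemma starB u v : star (u - v) = star u - star v.
Proof. by apply: (addIr (star v)); rewrite -starD !subrK. Qed.

Lemma mem_phys v : (v \in phys L) = (star v == 0).
Proof.
rewrite subr_eq0; apply/idP/eqP => [/memv_imgP[x _ ->]|e].
  by rewrite lfunE /= mul_col_mx mul1mx col_mxKu col_mxKd.
apply/memv_imgP; exists (usubmx v); rewrite ?memvf // lfunE /= mul_col_mx mul1mx -e.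
by rewrite vsubmxK.
Qed.

Lemma mem_Frho v : (v \in @Frho R d m) = (usubmx v == 0).
Proof.
apply/idP/eqP => [/memv_imgP[x _ ->]|e].
  by rewrite lfunE /= mul_col_mx mul0mx col_mxKu.
apply/memv_imgP; exists (dsubmx v); rewrite ?memvf // lfunE /= mul_col_mx mul1mx mul0mx -e.
by rewrite vsubmxK.
Qed.

Lemma capv_phys_Frho : (phys L :&: @Frho R d m = 0)%VS.
Proof.
apply/eqP; rewrite -subv0; apply/subvP => v; rewrite memv_cap mem_phys mem_Frho memv0.
rewrite /star => /andP[+ /eqP e]; rewrite e mulmx0 subr0 => /eqP e'.
by rewrite -[v]vsubmxK e e' col_mx0.
Qed.

Definition lift_star (w : 'cV[R]_m) : V := col_mx 0 w.

Lemma star_lift w : star (lift_star w) = w.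
Proof. by rewrite /star col_mxKd col_mxKu mulmx0 subr0. Qed.

Lemma sub_lift_star v : v - lift_star (star v) \in phys L.
Proof. by rewrite mem_phys starB star_lift subrr. Qed.

Lemma lift_star_Frho w : lift_star w \in @Frho R d m.
Proof. by rewrite mem_Frho col_mxKu. Qed.

Lemma rhoE v : rho L v = v - lift_star (star v).
Proof.
have h0 := capv_phys_Frho; rewrite /rho -{1}[v](subrK (lift_star (star v))).
rewrite linearD /= (daddv_pi_id h0) ?sub_lift_star //.
have -> : daddv_pi (phys L) (@Frho R d m) (lift_star (star v)) = 0; last by rewrite addr0.
have h0' : (@Frho R d m :&: phys L = 0)%VS by rewrite capvC.
have := daddv_pi_add h0 (w := lift_star (star v)).
rewrite (daddv_pi_id h0') ?lift_star_Frho // => /(_ _) h.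
apply: (addIr (lift_star (star v))); rewrite h ?add0r //.
by rewrite memvE (subv_trans _ (addvSr _ _)) // -memvE lift_star_Frho.
Qed.

Section Internal.
Variable F : {vspace V}.
Hypothesis adm : admissible L F.

Lemma projE_phys v : projE L F v \in phys L.
Proof. exact: memv_pi. Qed.

Lemma projE_projF v : projE L F v + projF L F v = v.
Proof. by case: adm => h e _; apply: daddv_pi_add => //; rewrite e memvf. Qed.

Lemma projED u v : projE L F (u + v) = projE L F u + projE L F v.
Proof. exact: linearD. Qed.

Lemma projEB u v : projE L F (u - v) = projE L F u - projE L F v.
Proof. exact: linearB. Qed.

Lemma star_projE v : star (projE L F v) = 0.
Proof. by apply/eqP; rewrite -mem_phys projE_phys. Qed.

Lemma star_projF v : star (projF L F v) = star v.
Proof. by rewrite -{2}[v]projE_projF starD star_projE add0r. Qed.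

(** [projF] moves a vector by an element of [E], where [star] vanishes; hence the slice is the same
    for all admissible [F]. *)
Lemma sliceP v : slice L F v <-> forall i, 0 <= star v i 0 <= 1.
Proof.
split=> [[w [c [c0 c1] <-] [e /= eE <-]] i|h].
  rewrite starD star_projF; move: eE; rewrite mem_phys => /eqP ->.
  by rewrite addr0 /star c0 mulmx0 subr0.
exists (projF L F (lift_star (star v))).
  by exists (lift_star (star v)) => //; rewrite /= col_mxKu col_mxKd.
exists (v - projF L F (lift_star (star v))); last by rewrite addrC subrK.
by rewrite /= mem_phys starB star_projF star_lift subrr.
Qed.

End Internal.
End Geometry.

Lemma integer_pointsP (R : realType) n (v : 'cV[R]_n) :
  integer_points v <-> exists x, v = int_vector R x.
Proof.
split=> [h|[x ->] i]; last by rewrite mxE intr_int.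
exists (\col_i Num.floor (v i 0)); apply/matrixP => i k.
by rewrite ord1 !mxE floorK.
Qed.

Lemma integer_pointsD (R : realType) n (u v : 'cV[R]_n) :
  integer_points u -> integer_points v -> integer_points (u + v).
Proof. by move=> hu hv i; rewrite mxE rpredD. Qed.

Lemma integer_pointsB (R : realType) n (u v : 'cV[R]_n) :
  integer_points u -> integer_points v -> integer_points (u - v).
Proof. by move=> hu hv i; rewrite !mxE rpredB. Qed.

Lemma int_vector_inj (R : realType) n : injective (@int_vector R n).
Proof.
move=> x y /matrixP h; apply/matrixP => i k; have := h i k.
by rewrite !mxE => /eqP; rewrite eqr_int => /eqP.
Qed.

Lemma coord_le_norm (R : realType) n (v : 'cV[R]_n) i : `|v i 0| <= `|v|.
Proof.
rewrite [leRHS]/Num.norm /= mx_normrE.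
exact: (le_bigmax _ (fun i : 'I_n * 'I_1 => `|v i.1 i.2|) (i, 0)).
Qed.

Lemma finite_integer_points (R : realType) n (A : set 'cV[R]_n) (M : R) :
  A `<=` integer_points -> (forall v i, A v -> `|v i 0| <= M) -> finite_set A.
Proof.
move=> Aint AM; pose N := Num.truncn M.
pose f (g : {ffun 'I_n -> 'I_(N + N).+1}) : 'cV[R]_n :=
  int_vector R (\col_i ((g i : nat)%:Z - N%:Z)).
apply: (@sub_finite_set _ _ (f @` setT)); last by apply: finite_image; exact: finite_finset.
move=> v Av; have [x e] := (integer_pointsP v).1 (Aint _ Av).
have xN i : `|x i 0| <= N%:Z.
  have := AM v i Av; rewrite e mxE -intr_norm => h.
  rewrite -abszE lez_nat truncn_ge_nat ?pmulrn ?abszE //.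
  by apply: le_trans h; rewrite ler0z.
exists [ffun i => inord (absz (x i 0 + N%:Z))] => //.
rewrite e /f; congr int_vector; apply/matrixP => i k; rewrite ord1 mxE ffunE.
have := xN i; rewrite ler_norml => /andP[h1 h2].
rewrite inordK; lia.
Qed.

(** The part of [z] that the projection removes is a linear function [T] of [star z], hence bounded
    when [star z] is. This serves type I with [F] and type II with [Frho]. *)
Lemma finite_stars (R : realType) d m (L : 'M[R]_(m, d)) (F : {vspace 'cV[R]_(d + m)})
    (Om : set 'cV[R]_(d + m)) (r : R) :
  (phys L :&: F = 0)%VS -> bounded_set Om ->
  finite_set [set z | [/\ integer_points z,
    [set r *: v | v in Om] (daddv_pi (phys L) F z) & forall i, `|star L z i 0| < 1]].
Proof.
move=> h0 [M [_ HM]]; pose pi v := daddv_pi (phys L) F v.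
pose M1 := `|M| + 1; have {}HM v : Om v -> `|v| <= M1.
  by move=> Ov; apply: HM => //; rewrite (le_lt_trans (ler_norm M)) // ltrDl.
pose T (w : 'cV[R]_m) : 'cV[R]_(d + m) := lift_star w - pi (lift_star w).
pose M2 : R := \sum_k \sum_i `|T (delta_mx k 0) i 0|.
have TD w : T w = \sum_k w k 0 *: T (delta_mx k 0).
  have TD' u v : T (u + v) = T u + T v.
    have e : lift_star (u + v) = lift_star u + lift_star v :> 'cV[R]_(d + m).
      by rewrite /lift_star add_col_mx addr0.
    by rewrite /T e /pi linearD /= opprD addrACA.
  have TZ a v : T (a *: v) = a *: T v.
    have e : lift_star (a *: v) = a *: lift_star v :> 'cV[R]_(d + m).
      by rewrite /lift_star scale_col_mx scaler0.
    by rewrite /T e /pi linearZ /= scalerBr.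
  have T0 : T 0 = 0 by rewrite -(scale0r 0) TZ scale0r.
  have {1}-> : w = \sum_k w k 0 *: delta_mx k 0.
    rewrite {1}[w]matrix_sum_delta; apply: eq_bigr => k _.
    by rewrite big_ord1.
  by rewrite (big_morph T TD' T0); apply: eq_bigr => k _; rewrite TZ.
have T_le (w : 'cV[R]_m) i : (forall k, `|w k 0| < 1) -> `|T w i 0| <= M2.
  move=> w1; rewrite TD summxE; apply: le_trans (ler_norm_sum _ _ _) _.
  apply: ler_sum => k _; rewrite mxE normrM.
  apply: (@le_trans _ _ `|T (delta_mx k 0) i 0|).
    by rewrite ler_piMl // ltW.
  by rewrite (bigD1 i) //= lerDl sumr_ge0.
apply: (@finite_integer_points _ _ _ (`|r| * M1 + M2)) => [z []|z i [_ [v Ov rv] z1]] //.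
have -> : z = pi z + T (star L z).
  have := daddv_pi_id h0 (sub_lift_star L z); rewrite linearB /= => e.
  move/eqP: e; rewrite subr_eq => /eqP e; rewrite /T /pi {1}e [RHS]addrC addrCA.
  by rewrite !subrK.
rewrite mxE; apply: le_trans (ler_normD _ _) _; apply: lerD; last exact: T_le.
rewrite /pi -rv mxE normrM ler_wpM2l //; apply: le_trans (HM v Ov); exact: coord_le_norm.
Qed.

(** * Lattice points of the slice, indexed by Z^d *)

Section Lattice.
Context {R : realType} {d m : nat}.
Local Notation V := 'cV[R]_(d + m).
Variables (L : 'M[R]_(m, d)) (F : {vspace V}) (adm : admissible L F) (s : V).
Hypothesis reg : regular_point L F s.

Definition torus_base (i : 'I_m) : R := star L s i 0.

Definition torus_at (n : 'cV[int]_d) : 'I_m -> R :=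
  torus_point L torus_base (fun j => (n j 0)%:~R).

(** The floors choose, among the points of [Z^k + s] over [n], the one whose [star] lies in
    [[0, 1)^m]. *)
Definition point_at (n : 'cV[int]_d) : V :=
  s + col_mx (int_vector R n)
    (\col_i - (Num.floor (torus_base i - \sum_j L i j * (n j 0)%:~R))%:~R).

Lemma star_point_at n i : star L (point_at n) i 0 = torus_at n i.
Proof.
rewrite /point_at starD mxE -/(torus_base i) /torus_at /torus_point /frac.
have -> : star L (col_mx (int_vector R n)
    (\col_i - (Num.floor (torus_base i - \sum_j L i j * (n j 0)%:~R))%:~R)) i 0
  = - (Num.floor (torus_base i - \sum_j L i j * (n j 0)%:~R))%:~R
    - \sum_j L i j * (n j 0)%:~R.
  rewrite /star col_mxKd col_mxKu !mxE; congr (_ - _).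
  by apply: eq_bigr => j _; rewrite !mxE.
by ring.
Qed.

Lemma usubmx_point_at n : usubmx (point_at n) = usubmx s + int_vector R n.
Proof. by rewrite /point_at linearD /= col_mxKu. Qed.

Lemma lattice_point_at n : lattice s (point_at n).
Proof.
exists (point_at n - s); last by rewrite subrK.
rewrite /point_at addrC addKr => i; rewrite mxE.
by case: splitP => k _; rewrite !mxE ?rpredN intr_int.
Qed.

Lemma slice_point_at n : slice L F (point_at n).
Proof.
apply/(sliceP adm) => i; rewrite star_point_at.
by have /andP[-> /ltW ->] := frac_itv (torus_base i - \sum_j L i j * (n j 0)%:~R).
Qed.

(** If a coordinate of [star v] were 0 or 1, arbitrarily small moves along it would leave the slice;
    [v] would then be a lattice point of the boundary, against regularity. *)
Lemma slice_interior v : lattice s v -> slice L F v -> forall i, 0 < star L v i 0 < 1.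
Proof.
move=> lv sv i; have /(sliceP adm)/(_ i) /andP[h0 h1] := sv.
have nb : ~ boundary (slice L F) v.
  by move=> bv; have : (boundary (slice L F) `&` lattice s) v by []; rewrite reg.
have edge (e : R) : e != 0 -> `|e| = 1 ->
    (forall x : R, 0 < x -> ~ (0 <= star L v i 0 + e * x <= 1)) -> False.
  move=> e0 e1 out; apply: nb; split; first exact: subset_closure.
  move=> /nbhs_ballP[r /= r0 Hr].
  pose w := v + lift_star ((e * (r / 2)) *: delta_mx i 0).
  have : ball v r w.
    split=> // a b; rewrite ord1 /ball /= /w !mxE opprD addrA subrr sub0r normrN.
    have ne : `|e * (r / 2)| = r / 2 by rewrite normrM e1 mul1r ger0_norm // divr_ge0 // ltW.
    case: splitP => k _; rewrite !mxE ?normr0 // normrM ne.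
    by case: (_ && _); rewrite ?normr0 ?normr1 ?mulr0 ?mulr1 //; lra.
  have sw : star L w i 0 = star L v i 0 + e * (r / 2).
    by rewrite /w starD star_lift [LHS]mxE; congr (_ + _); rewrite !mxE !eqxx mulr1.
  by move=> /Hr /(sliceP adm) /(_ i); rewrite sw; apply: out; rewrite divr_gt0.
rewrite lt0r h0 andbT [_ < 1]lt_neqAle h1 andbT; apply/andP; split; apply/eqP => e.
  apply: (edge (-1)); rewrite ?oppr_eq0 ?oner_eq0 // ?normrN1 // => x x0 /andP[].
  by rewrite e; lra.
apply: (edge 1); rewrite ?oner_eq0 ?normr1 // => x x0 /andP[].
by rewrite e; lra.
Qed.

(** Points of [Z^k + s] with the same first [d] coordinates have [star] differing by an integer
    vector, and here both values lie in [[0, 1)^m]. *)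
Lemma point_at_unique v n : lattice s v -> slice L F v ->
  usubmx v = usubmx s + int_vector R n -> v = point_at n.
Proof.
move=> lv sv vn; have itv01 := slice_interior lv sv.
have [z zint zs] := lv; have [x ex] := (integer_pointsP z).1 zint.
have vE : dsubmx v = L *m usubmx v + star L v by rewrite /star addrC subrK.
suff dE : star L v = star L (point_at n).
  rewrite -[LHS]vsubmxK -[RHS]vsubmxK; congr col_mx; first by rewrite usubmx_point_at.
  rewrite vE dE /star usubmx_point_at vn addrC subrK //.
apply/matrixP => i k; rewrite ord1 star_point_at.
have [e He] : exists e : int, star L v i 0 = torus_base i - \sum_j L i j * (n j 0)%:~R - e%:~R.
  exists (- (x (rshift d i) 0)).
  rewrite -zs starD mxE [LHS]addrC /torus_base -addrA; congr (_ + _).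
  have uz : usubmx z = int_vector R n.
    by apply: (addIr (usubmx s)); rewrite -linearD /= zs vn addrC.
  rewrite /star uz !mxE ex !mxE rmorphN opprK addrC; congr (- _ + _).
  by apply: eq_bigr => j _; rewrite !mxE.
rewrite He; apply/esym/frac_eq; rewrite -He.
by have /andP[/ltW -> ->] := itv01 i.
Qed.

Lemma lattice_sliceP v : lattice s v -> slice L F v -> exists n, v = point_at n.
Proof.
move=> lv sv; have [z zint zs] := lv; have [x ex] := (integer_pointsP z).1 zint.
exists (usubmx x); apply: point_at_unique => //.
rewrite -zs linearD /= addrC; congr (_ + _); rewrite ex.
by apply/matrixP => i k; rewrite !mxE.
Qed.

Lemma torus_at_itv n i : 0 < torus_at n i < 1.
Proof.
by rewrite -star_point_at; apply: slice_interior; [exact: lattice_point_at|exact: slice_point_at].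
Qed.

Lemma projE_lattice_inj : {in lattice s &, injective (projE L F)}.
Proof.
move=> u v; rewrite !inE => -[a ai <-] [b bi <-].
rewrite !projED // => /addIr; case: adm => _ _ inj /inj; rewrite !inE.
by move=> /(_ ai bi) ->.
Qed.

Definition cps_at n := projE L F (point_at n).

Lemma cpsP y : cps L F s y <-> exists n, y = cps_at n.
Proof.
split=> [[v [sv lv] <-]|[n ->]].
  by have [n ->] := lattice_sliceP lv sv; exists n.
exists (point_at n) => //; split; [exact: slice_point_at|exact: lattice_point_at].
Qed.

Lemma tilde_cps_at n : tilde L F s (cps_at n) = point_at n.
Proof.
rewrite /tilde; case: xgetP => [z _ [lz e]|/(_ (point_at n)) []].
  by apply: projE_lattice_inj => //; rewrite inE //; exact: lattice_point_at.
by split => //; exact: lattice_point_at.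
Qed.

Lemma point_at_inj : injective point_at.
Proof.
by move=> n n' /(congr1 usubmx); rewrite !usubmx_point_at => /addrI /int_vector_inj.
Qed.

Lemma cps_at_inj : injective cps_at.
Proof.
by move=> n n' /(congr1 (tilde L F s)); rewrite !tilde_cps_at => /point_at_inj.
Qed.

Lemma point_atB_int n n' : integer_points (point_at n' - point_at n).
Proof.
have [z zi e] := lattice_point_at n'; have [z' zi' e'] := lattice_point_at n.
by rewrite -e -e' opprD addrACA subrr addr0; exact: integer_pointsB.
Qed.

Lemma usubmx_point_atB n n' :
  usubmx (point_at n' - point_at n) = int_vector R (n' - n).
Proof.
rewrite linearB /= !usubmx_point_at opprD addrACA subrr add0r.
by apply/matrixP => i k; rewrite !mxE rmorphB.
Qed.

End Lattice.

(** * Steps between the points of a patch *)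

Section PatchSteps.
Context {R : realType} {d m : nat}.
Local Notation V := 'cV[R]_(d + m).
Variables (L : 'M[R]_(m, d)) (F : {vspace V}) (adm : admissible L F).
Variable P : patch_class R d m.

Definition in_region (z : V) : Prop :=
  match class_type P with
  | TypeI => [set class_radius P *: v | v in class_region P] (projE L F z)
  | TypeII => [set class_radius P *: v | v in class_region P] (rho L z)
  end.

(** The candidates for [tilde y' - tilde y] in a patch. The bound on [star] holds for any two points
    interior to the slice and makes the set finite when the region is bounded. *)
Definition patch_steps : set V :=
  [set z | [/\ integer_points z, in_region z & forall i, `|star L z i 0| < 1]].

Lemma finite_patch_steps : bounded_set (class_region P) -> finite_set patch_steps.
Proof.
case: adm => h0 _ _ bOm; rewrite /patch_steps /in_region; case: (class_type P).
  exact: finite_stars h0 bOm.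
exact: finite_stars (capv_phys_Frho L) bOm.
Qed.

(** From the position [x] modulo [E], a step with transversal part [w] ends in the slice. *)
Definition fits (x : 'I_m -> R) (w : 'cV[R]_m) : bool :=
  [forall i, 0 <= x i + w i 0 <= 1].

Lemma projE_int_inj u v : integer_points u -> integer_points v ->
  projE L F u = projE L F v -> u = v.
Proof. by move=> iu iv; case: adm => _ _ inj; apply: inj; rewrite inE. Qed.

Section Class.
Variable s : V.
Hypothesis reg : regular_point L F s.

Lemma slice_point_atD n z :
  slice L F (point_at L s n + z) <-> fits (torus_at L s n) (star L z).
Proof.
split=> [/(sliceP adm) h|/forallP h].
  by apply/forallP => i; have := h i; rewrite starD mxE star_point_at.
by apply/(sliceP adm) => i; rewrite starD mxE star_point_at; exact: h.
Qed.

Lemma lattice_point_atD n z : integer_points z -> lattice s (point_at L s n + z).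
Proof.
move=> iz; have [z' iz' <-] := lattice_point_at L s n.
by exists (z' + z); [exact: integer_pointsD | rewrite addrAC].
Qed.

Lemma fits_step n z : fits (torus_at L s n) (star L z) -> integer_points z ->
  forall i, `|star L z i 0| < 1.
Proof.
move=> h iz i; have /(slice_point_atD n z) sz := h.
have := slice_interior adm reg (lattice_point_atD n iz) sz i.
rewrite starD mxE star_point_at; have := torus_at_itv adm reg n i.
by rewrite ltr_norml => /andP[h1 h2] /andP[h3 h4]; apply/andP; split; lra.
Qed.

Lemma patch_shapeE n :
  [set y' - cps_at L F s n | y' in cps_patch L F s (class_type P) (class_radius P)
     (class_region P) (cps_at L F s n)]
  = [set projE L F z | z in [set z | patch_steps z /\ fits (torus_at L s n) (star L z)]].
Proof.
apply/seteqP; split=> [_ [y' [cy' hy'] <-]|_ [z [[iz Gz z1] fz] <-]].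
  have [n' e] := (cpsP adm reg y').1 cy'; subst y'.
  set z := point_at L s n' - point_at L s n.
  have iz : integer_points z by exact: point_atB_int.
  have fz : fits (torus_at L s n) (star L z).
    by apply/slice_point_atD; rewrite /z addrC subrK; exact: slice_point_at.
  exists z; last by rewrite projEB.
  split=> //; split=> //; last exact: fits_step fz iz.
  move: hy'; rewrite /in_region !tilde_cps_at //.
  by case: (class_type P) => //; rewrite -projEB.
have [n' e] := lattice_sliceP adm reg (lattice_point_atD n iz) ((slice_point_atD n z).2 fz).
have ze : z = point_at L s n' - point_at L s n by rewrite -e addrC addKr.
exists (cps_at L F s n'); last by rewrite ze projEB.
split; first by apply/(cpsP adm reg); exists n'.
move: Gz; rewrite /in_region !tilde_cps_at // -ze.
by case: (class_type P) => //; rewrite ze projEB.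
Qed.

Lemma has_classE n : has_class L F s P (cps_at L F s n) <->
  [set projE L F z | z in [set z | patch_steps z /\ fits (torus_at L s n) (star L z)]]
    = class_shape P.
Proof.
rewrite -patch_shapeE /has_class /class_of; case: P => ty r Om sh /=.
by split=> [[]//|->].
Qed.

(** The point [n1] guarantees that the shape consists of projected steps; as [projE] is injective on
    integer points, equality of shapes can be tested step by step. *)
Lemma has_class_steps n1 n : has_class L F s P (cps_at L F s n1) ->
  has_class L F s P (cps_at L F s n) <->
  forall z, patch_steps z ->
    (fits (torus_at L s n) (star L z) <-> class_shape P (projE L F z)).
Proof.
move=> /has_classE h1; rewrite has_classE; split=> [<- z sz|h].
  split=> [fz|[z' [[iz' _ _] fz'] e]]; first by exists z.
  by case: sz => iz _ _; rewrite -(projE_int_inj iz' iz e).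
apply/seteqP; split=> [_ [z [sz fz] <-]|y ysh]; first by apply/h.
move: (ysh); rewrite -{1}h1 => -[z [sz _] e]; exists z => //; split => //.
by apply/(h z sz); rewrite e.
Qed.

End Class.
End PatchSteps.

(** * Patch classes as boolean combinations of boxes *)

(* In type II the horizontal parts of the steps are prescribed and each of them is
   realised by exactly one step, so the steps that fit determine those that do not. *)
Lemma has_class_steps_typeII (R : realType) d m (L : 'M[R]_(m, d))
    (F : {vspace 'cV[R]_(d + m)}) (P : patch_class R d m) s n1 n :
  admissible L F -> regular_point L F s -> class_type P = TypeII ->
  has_class L F s P (cps_at L F s n1) ->
  has_class L F s P (cps_at L F s n) <->
  forall z, patch_steps L F P z -> class_shape P (projE L F z) ->
    fits (torus_at L s n) (star L z).
Proof.
move=> adm reg tyP h1; rewrite (has_class_steps adm reg n h1).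
have h1' := (has_class_steps adm reg n1 h1).1 h1.
split=> [h z sz /(h z sz) //|h z sz]; split; last exact: h.
move=> fz; have [iz Gz z1] := sz.
have [x ex] := (integer_pointsP z).1 iz.
have ux : usubmx z = int_vector R (usubmx x) by rewrite ex; apply/matrixP => i k; rewrite !mxE.
(* The step from [n1] with the same first [d] coordinates as [z], on which alone [rho] depends. It
   fits at [n1], so it belongs to the shape and fits at [n] too; only one point of the slice lies
   over each index, so [z = z']. *)
pose z' := point_at L s (n1 + usubmx x) - point_at L s n1.
have uz' : usubmx z' = usubmx z by rewrite usubmx_point_atB addrC addKr ux.
have iz' : integer_points z' := point_atB_int L s _ _.
have fz' : fits (torus_at L s n1) (star L z').
  by apply/(slice_point_atD adm); rewrite addrC subrK; exact: slice_point_at.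
have sz' : patch_steps L F P z'.
  split=> //; last exact: (fits_step adm reg fz' iz').
  move: Gz; rewrite /in_region tyP !rhoE // /lift_star.
  have e (v : 'cV[R]_(d + m)) : v - col_mx 0 (star L v) = col_mx (usubmx v) (L *m usubmx v).
    by rewrite -{1}[v]vsubmxK opp_col_mx add_col_mx oppr0 addr0 /star opprB addrC subrK.
  by rewrite !e uz'.
have fnz' := h z' sz' ((h1' z' sz').1 fz').
suff -> : z = z' by apply/(h1' z' sz').
have eq_pt w : integer_points w -> fits (torus_at L s n) (star L w) -> usubmx w = usubmx z ->
    point_at L s n + w = point_at L s (n + usubmx x).
  move=> iw fw uw; apply: (point_at_unique adm reg).
  - exact: lattice_point_atD.
  - exact/(slice_point_atD adm).
  - rewrite linearD /= usubmx_point_at uw ux -addrA; congr (_ + _).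
    by apply/matrixP => i k; rewrite !mxE rmorphD.
by apply: (addrI (point_at L s n)); rewrite !eq_pt.
Qed.

Section Patterns.
Variables (R : realType) (m : nat).
Implicit Types (x : 'I_m -> R) (zp zn : seq 'cV[R]_m).

Definition pattern zp zn x : bool := all (fits x) zp && ~~ has (fits x) zn.

Lemma fits_box zp : exists a b : 'I_m -> R,
  [/\ forall i, 0 <= a i, forall i, b i <= 1
    & forall x, (forall i, 0 <= x i <= 1) ->
        all (fits x) zp = [forall i, a i <= x i <= b i]].
Proof.
elim: zp => [|w zp [a [b [a0 b1 ab]]]].
  exists (fun=> 0), (fun=> 1); split=> // x x01.
  by apply/esym/forallP.
exists (fun i => Num.max (a i) (- w i 0)), (fun i => Num.min (b i) (1 - w i 0)).
split=> [i|i|x x01]; first by rewrite le_max a0.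
  by rewrite ge_min b1.
rewrite /= ab //; apply/andP/forallP => [[/forallP h1 /forallP h2] i|h].
  have /andP[p1 p2] := h1 i; have /andP[p3 p4] := h2 i.
  by rewrite ge_max le_min p3 p4 /=; apply/andP; split; lra.
split; apply/forallP => i; have := h i; rewrite ge_max le_min => /andP[/andP[p1 p2] /andP[p3 p4]].
  by apply/andP; split; lra.
by rewrite p1 p3.
Qed.

Lemma pattern_cons zp zn w x :
  (pattern zp (w :: zn) x)%:R
  = (pattern zp zn x)%:R - (pattern (w :: zp) zn x)%:R :> R.
Proof.
rewrite /pattern /=; case: (fits x w); case: (all _ _); case: (has _ _) => /=.
all: by rewrite ?subrr ?subr0.
Qed.

Variables (d : nat) (L : 'M[R]_(m, d)) (C : R).
Hypothesis L_good : forall i (t a b : 'I_m -> R),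
  (forall j, 0 <= a j) -> (forall j, b j <= 1) ->
  `|box_count L (2 ^ i) t a b - (2 ^ i)%:R ^+ d * box_volume a b| <= C * (3 / 2) ^+ i.

Lemma pattern_discrepancy zp zn : exists mu : R, forall (t : 'I_m -> R) i c,
  `|cube_sum (fun n => (pattern zp zn (torus_point L t (fun j => (n j 0)%:~R)))%:R - mu)
      (2 ^ i) c| <= 2 ^+ size zn * C * (3 / 2) ^+ i.
Proof.
elim: zn zp => [|w zn IH] zp.
  have [a [b [a0 b1 ab]]] := fits_box zp; exists (box_volume a b) => t i c.
  (* The corner [c] of the cube is absorbed in the base point. *)
  pose t' k := t k - \sum_j L k j * (c j 0)%:~R.
  rewrite expr0 mul1r; apply: le_trans (L_good i t' a0 b1).
  rewrite /cube_sum sumrB sumr_const card_ffun !card_ord -natrX mulr_natl /box_count.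
  rewrite le_eqVlt; apply/orP; left; apply/eqP; congr `|_ - _|; apply: eq_bigr => u _.
  have e k : torus_point L t (fun j => ((c + cube_offset u) j 0)%:~R) k
      = torus_point L t' (fun j => (u j)%:R) k.
    rewrite /torus_point /t'; congr frac; rewrite -addrA -opprD -big_split /=; congr (_ - _).
    by apply: eq_bigr => j _; rewrite !mxE rmorphD /= -pmulrn mulrDr.
  rewrite /pattern andbT ab; last first.
    move=> k; have /andP[-> /ltW ->] // :=
      frac_itv (t k - \sum_j L k j * ((c + cube_offset u) j 0)%:~R).
  set x := torus_point L t _ in e *.
  have [/forallP h|/forallPn[k /negPf hk]] := boolP [forall k, a k <= x k <= b k].
    by rewrite big1 // => k _; rewrite -e h.
  by rewrite (bigD1 k) //= -e hk mul0r.
have [mu1 h1] := IH zp; have [mu2 h2] := IH (w :: zp).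
exists (mu1 - mu2) => t i c.
set f1 := fun n : 'cV[int]_d =>
  (pattern zp zn (torus_point L t (fun j => (n j 0)%:~R)))%:R - mu1.
set f2 := fun n : 'cV[int]_d =>
  (pattern (w :: zp) zn (torus_point L t (fun j => (n j 0)%:~R)))%:R - mu2.
have -> : cube_sum (fun n => (pattern zp (w :: zn)
      (torus_point L t (fun j => (n j 0)%:~R)))%:R - (mu1 - mu2)) (2 ^ i) c
    = cube_sum f1 (2 ^ i) c - cube_sum f2 (2 ^ i) c.
  rewrite /cube_sum -sumrB; apply: eq_bigr => u _.
  by rewrite pattern_cons /f1 /f2; ring.
apply: le_trans (ler_normB _ _) _; apply: le_trans (lerD (h1 t i c) (h2 t i c)) _.
by rewrite /= exprS -!mulrA [leRHS]mulr_natl mulr2n.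
Qed.

End Patterns.

(** * Frequencies *)

Lemma ncard_image_seq (T : eqType) (U : choiceType) (f : T -> U) (X : seq T) :
  injective f -> uniq X -> ncard (f @` [set` X]) = size X.
Proof.
move=> f_inj uX; rewrite /ncard -(size_map f).
have -> : f @` [set` X] = [set` [fset y in map f X]%fset].
  apply/seteqP; split=> [_ [x /= xX <-]|y /=]; rewrite in_fset.
    exact: map_f.
  by move=> /mapP[x xX ->]; exists x.
by rewrite set_fsetK card_fseq undup_id // map_inj_uniq.
Qed.

Definition centered_box (d T : nat) : seq 'cV[int]_d :=
  [seq cube_offset u - const_mx T%:Z | u : {ffun 'I_d -> 'I_(T + T).+1}].

Lemma absz_shift (T : nat) (z : int) : `|z| <= T%:Z ->
  (absz (z + T%:Z)%R < (T + T).+1)%N /\ z = (absz (z + T%:Z))%:Z - T%:Z.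
Proof. by rewrite ler_norml => /andP[h1 h2]; split; lia. Qed.

Lemma mem_centered_box d T (n : 'cV[int]_d) :
  (n \in centered_box d T) <-> forall i, `|n i 0| <= T%:Z.
Proof.
split=> [/mapP[u _ ->] i|h].
  rewrite !mxE ler_norml lerBrDr addNr lerBlDr -PoszD !lez_nat /=.
  by rewrite -ltnS ltn_ord.
apply/mapP; exists [ffun i => inord (absz (n i 0 + T%:Z))]; first by rewrite mem_enum.
apply/matrixP => i k; rewrite ord1 !mxE ffunE.
by have [h1 h2] := absz_shift (h i); rewrite inordK.
Qed.

Lemma centered_box_uniq d T : uniq (centered_box d T).
Proof.
rewrite map_inj_uniq ?enum_uniq // => u v /addIr /matrixP h.
apply/ffunP => i; apply/val_inj; have := h i 0; rewrite !mxE => e.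
by apply/eqP; rewrite -eqz_nat e.
Qed.

Lemma size_centered_box d T : size (centered_box d T) = ((T + T).+1 ^ d)%N.
Proof. by rewrite size_map -cardE card_ffun !card_ord. Qed.

(* The translates of the exit face by multiples of the unit step are disjoint. *)
Lemma exits_centered_box d T (j : 'I_d) :
  (exits (centered_box d T) (unit_step j) * (T + T).+1 <= size (centered_box d T))%N.
Proof.
set X := centered_box d T; pose E := [seq x <- X | x + unit_step j \notin X].
have EP x : x \in E -> (forall i, `|x i 0| <= T%:Z) /\ x j 0 = T%:Z.
  rewrite mem_filter => /andP[/negP xj /mem_centered_box xX]; split=> //.
  apply/eqP; apply: contraT => ne; exfalso; apply: xj.
  apply/mem_centered_box => i; rewrite !mxE eqxx andbT; have := xX i; have := xX j.
  have [->|ij] := eqVneq i j; rewrite !ler_norml; last by rewrite addr0.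
  by move=> h _; move: h ne => /=; lia.
have sE : size [seq x - unit_step j *+ k | x <- E, k <- iota 0 (T + T).+1]
    = (exits X (unit_step j) * (T + T).+1)%N.
  by rewrite size_allpairs size_iota size_filter.
rewrite -sE; apply: uniq_leq_size.
  apply: allpairs_uniq; rewrite ?iota_uniq ?filter_uniq ?centered_box_uniq //.
  move=> [a b] [a' b'] /allpairsPdep[u [v [aE _ [-> ->]]]].
  move=> /allpairsPdep[u' [v' [a'E _ [-> ->]]]] /= e.
  have /(congr1 (fun v : 'cV[int]_d => v j 0)) := e.
  have [_ hj] := EP u aE; have [_ hj'] := EP u' a'E.
  rewrite !mxE !mulmxnE !mxE !eqxx hj hj' /= => e'.
  have bb : v = v' by move: e'; rewrite !natz; lia.
  by move: e; rewrite bb => /addIr ->.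
move=> y /allpairsPdep[x [k [xE kT ->]]]; have [hx hj] := EP x xE.
move: kT; rewrite mem_iota /= => kT.
apply/mem_centered_box => i; rewrite !mxE mulmxnE !mxE eqxx andbT.
have [->|ij] := eqVneq i j; last by rewrite mul0rn subr0; exact: hx.
by rewrite hj ler_norml natz; lia.
Qed.

Section Proportion.
Variables (R : realType) (d m : nat) (L : 'M[R]_(m, d)) (F : {vspace 'cV[R]_(d + m)}).
Variables (adm : admissible L F) (s : 'cV[R]_(d + m)) (reg : regular_point L F s).
Variable P : patch_class R d m.

Definition class_at (n : 'cV[int]_d) : bool := `[< has_class L F s P (cps_at L F s n) >].

Lemma proportion_count (D : set 'cV[R]_(d + m)) (n0 : 'cV[int]_d) (X : seq 'cV[int]_d) :
  uniq X -> (forall n, D (point_at L s n - point_at L s n0) <-> n - n0 \in X) ->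
  proportion L F s P (cps_at L F s n0) D
  = (count (fun x => class_at (n0 + x)) X)%:R / (size X)%:R.
Proof.
move=> uX DX; pose f x := cps_at L F s (n0 + x).
have f_inj : injective f by move=> x y /(cps_at_inj adm) /addrI.
rewrite /proportion; congr (_%:R / _%:R).
  rewrite -size_filter -(ncard_image_seq f_inj (filter_uniq _ uX)); congr ncard.
  apply/seteqP; split=> [y' [/(cpsP adm reg) [n ->] cn]|_ [x /= + <-]].
    rewrite !tilde_cps_at // DX => nX; exists (n - n0); last by rewrite /f subrKC.
    by rewrite /= mem_filter nX andbT /class_at subrKC; apply/asboolP.
  rewrite mem_filter => /andP[/asboolP cx xX]; split=> //.
    by apply/(cpsP adm reg); exists (n0 + x).
  by rewrite !tilde_cps_at // DX addrC addKr.
rewrite -(ncard_image_seq f_inj uX); congr ncard.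
apply/seteqP; split=> [y' [/(cpsP adm reg) [n ->]]|_ [x /= + <-]].
  by rewrite !tilde_cps_at // DX => nX; exists (n - n0); rewrite // /f subrKC.
move=> xX; split; first by apply/(cpsP adm reg); exists (n0 + x).
by rewrite !tilde_cps_at // DX addrC addKr.
Qed.

Variables (mu K : R) (K0 : 0 <= K) (d_ge2 : (2 <= d)%N).
Hypothesis cube_bound : forall i c,
  `|cube_sum (fun n => (class_at n)%:R - mu) (2 ^ i) c| <= K * (3 / 2) ^+ i.

Lemma count_estimate (X : seq 'cV[int]_d) n0 : uniq X -> (0 < size X)%N ->
  `|(count (fun x => class_at (n0 + x)) X)%:R / (size X)%:R - mu|
    <= 8 * K * (\sum_j exits X (unit_step j))%:R / (size X)%:R.
Proof.
move=> uX X0; have XR : 0 < (size X)%:R :> R by rewrite ltr0n.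
have := @boundary_estimate R d d_ge2 (fun x => (class_at (n0 + x))%:R - mu) K X uX K0.
have h i x : `|cube_sum (fun x => (class_at (n0 + x))%:R - mu) (2 ^ i) x| <= K * (3 / 2) ^+ i.
  apply: le_trans (cube_bound i (n0 + x)); rewrite le_eqVlt; apply/orP; left; apply/eqP.
  by congr `|_|; apply: eq_bigr => u _; rewrite addrA.
move=> /(_ h); rewrite sumrB -(ler_pM2r (_ : 0 < (size X)%:R^-1)) ?invr_gt0 //.
apply: le_trans; rewrite le_eqVlt; apply/orP; left; apply/eqP.
rewrite -[X in _ = _ * X]gtr0_norm ?invr_gt0 // -normrM mulrBl; congr `|_ - _|.
  congr (_ / _); rewrite -sum1_count natr_sum [in LHS]big_mkcond /=.
  by apply: eq_bigr => x _; case: class_at.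
by rewrite big_const_seq count_predT iter_addr_0 -[mu *+ _]mulr_natr mulfK ?gt_eqF.
Qed.

(** The slab selects the indices of a centred box of side [2T + 1], whose exits in each direction
    are at most a fraction [1 / (2T + 1)] of its points. So the limit is [mu], whatever the base
    point. *)
Lemma frequency_eq (n0 : 'cV[int]_d) : frequency L F s P (cps_at L F s n0) = mu.
Proof.
apply: cvg_lim => //; apply/cvgrPdist_le => e e0.
near=> t.
have t0 : 0 < t by near: t; apply: nbhs_pinfty_gt; rewrite num_real.
have te : 8 * K * d%:R / e <= t by near: t; apply: nbhs_pinfty_ge; rewrite num_real.
pose T := Num.truncn t.
have X0 : (0 < size (centered_box d T))%N by rewrite size_centered_box expn_gt0.
rewrite (@proportion_count (slab t) n0 (centered_box d T)); last 2 first.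
- exact: centered_box_uniq.
- move=> n; rewrite mem_centered_box; have u := usubmx_point_atB L s n0 n.
  split=> [[_ h] i|h].
    have := h i; rewrite u mxE -ler_norml -intr_norm => h'.
    rewrite -abszE lez_nat truncn_ge_nat ?(ltW t0) // pmulrn abszE //.
  split; first exact: point_atB_int.
  move=> i; rewrite u mxE -ler_norml -intr_norm.
  apply: (@le_trans _ _ (T%:Z%:~R)); first by rewrite ler_int; exact: h.
  by rewrite -pmulrn truncn_le ltW.
rewrite distrC; apply: le_trans (count_estimate n0 (centered_box_uniq d T) X0) _.
have XR : 0 < (size (centered_box d T))%:R :> R by rewrite ltr0n.
rewrite ler_pdivrMr //.
have ex : (\sum_j exits (centered_box d T) (unit_step j))%:R * t
    <= d%:R * (size (centered_box d T))%:R :> R.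
  apply: (@le_trans _ _ (((\sum_j exits (centered_box d T) (unit_step j)) * (T + T).+1)%N%:R)).
    rewrite natrM ler_wpM2l //; apply: le_trans (ltW (truncnS_gt t)) _.
    by rewrite ler_nat -/T; lia.
  rewrite -natrM ler_nat big_distrl /= -[X in (_ <= X * _)%N](card_ord d) -sum_nat_const.
  by apply: leq_sum => j _; exact: exits_centered_box.
move: ex te XR; move: (\sum_j exits _ _)%:R (size _)%:R => E S ex te S0.
rewrite ler_pdivrMr // in te.
have K8 : 0 <= 8 * K by rewrite mulr_ge0.
rewrite -(ler_pM2r t0); apply: (@le_trans _ _ (8 * K * (d%:R * S))).
  have -> : 8 * K * E * t = 8 * K * (E * t) by ring.
  by rewrite ler_wpM2l.
have -> : 8 * K * (d%:R * S) = 8 * K * d%:R * S by ring.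
have -> : e * S * t = t * e * S by ring.
by rewrite ler_wpM2r // ltW.
Unshelve. all: by end_near.
Qed.

End Proportion.

Lemma search_points_seq (R : realType) d m (A : set 'cV[R]_(d + m)) : bounded_set A ->
  exists2 X : seq 'cV[int]_d, uniq X & search_points A = int_vectors R X.
Proof.
move=> [M [_ HM]]; pose M1 := `|M| + 1.
have {}HM v : A v -> `|v| <= M1.
  by move=> Av; apply: HM => //; rewrite (le_lt_trans (ler_norm M)) // ltrDl.
have /finite_seqP[S SE] : finite_set (search_points A).
  apply: (@finite_integer_points _ _ _ M1) => [v []//|_ i [_ [a Aa <-]]].
  by rewrite mxE; apply: le_trans (HM a Aa); exact: coord_le_norm.
pose fl (v : 'cV[R]_d) : 'cV[int]_d := \col_i Num.floor (v i 0).
have flK x : fl (int_vector R x) = x.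
  by apply/matrixP => i k; rewrite ord1 !mxE intrKfloor.
exists (undup (map fl S)); first exact: undup_uniq.
rewrite SE; apply/seteqP; split=> [v /= vS|_ [x /= + <-]].
  have [x e] : exists x, v = int_vector R x.
    by apply/integer_pointsP; suff [] : search_points A v by []; rewrite SE.
  exists x; last by rewrite e.
  by rewrite /= mem_undup; apply/mapP; exists v; rewrite // e flK.
rewrite mem_undup => /mapP[v vS ->].
have [x' e] : exists x, v = int_vector R x.
  by apply/integer_pointsP; suff [] : search_points A v by []; rewrite SE.
by rewrite e flK -e.
Qed.

Section FrequencyBound.
Variables (R : realType) (d m : nat) (L : 'M[R]_(m, d)) (C c : R).
Hypothesis d_ge2 : (2 <= d)%N.
Hypothesis C_gt0 : 0 < C.
Hypothesis L_good : forall i (t a b : 'I_m -> R),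
  (forall j, 0 <= a j) -> (forall j, b j <= 1) ->
  `|box_count L (2 ^ i) t a b - (2 ^ i)%:R ^+ d * box_volume a b| <= C * (3 / 2) ^+ i.
Hypothesis c_gt0 : 0 < c.
Hypothesis exits_le : forall (X : seq 'cV[int]_d) j, uniq X ->
  ((exits X (unit_step j))%:R%:E
    <= c%:E * hausdorff d.-1 (boundary (cube_complex (int_vectors R X))))%E.
Variables (F : {vspace 'cV[R]_(d + m)}) (adm : admissible L F) (P : patch_class R d m).

(** The constant collects 8 from [boundary_estimate], [2^|zn| C] from [pattern_discrepancy], and [c]
    for each of the [d] directions of exit. *)
Lemma frequency_bound_pattern (zp zn : seq 'cV[R]_m) :
  (forall s, regular_point L F s -> is_patch_class L F s P -> forall n,
     has_class L F s P (cps_at L F s n) <-> pattern zp zn (torus_at L s n)) ->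
  frequency_bound L F P (8 * (2 ^+ size zn * C) * (d%:R * c)).
Proof.
move=> classE s reg sP y0 y cy0 cy A AE Ab [v0 Av0].
have [n0 e0] := (cpsP adm reg y0).1 cy0; have [n1 e1] := (cpsP adm reg y).1 cy.
subst y0 y.
have [X uX XE] := search_points_seq Ab.
have X0 : (0 < size X)%N.
  by move: Av0; rewrite XE => -[x /= xX _]; case: (X) xX.
have [mu hmu] := pattern_discrepancy L_good zp zn.
pose K := 2 ^+ size zn * C.
have K0 : 0 <= K by rewrite mulr_ge0 ?exprn_ge0 // ltW.
have bound i x : `|cube_sum (fun n => (class_at L F s P n)%:R - mu) (2 ^ i) x|
    <= K * (3 / 2) ^+ i.
  apply: le_trans (hmu (torus_base L s) i x); rewrite le_eqVlt; apply/orP; left; apply/eqP.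
  congr `|_|; apply: eq_bigr => u _; congr ((nat_of_bool _)%:R - _).
  by apply/idP/idP => [/asboolP/(classE s reg sP) //|/(classE s reg sP) h]; exact/asboolP.
rewrite (frequency_eq adm reg K0 d_ge2 bound).
have Xint n : int_vectors R X (int_vector R n) <-> n \in X.
  by split=> [[x /= xX /int_vector_inj <-]|nX] //; exists n.
rewrite /local_frequency (proportion_count adm reg P uX) => [|n]; last first.
  rewrite -Xint -XE; have un := usubmx_point_atB L s n1 n.
  split=> [[a Aa [f /= fF e]]|[ni [a Aa e]]].
    split; first by apply/integer_pointsP; exists (n - n1).
    exists a => //; rewrite -un -e linearD /=.
    by move: fF; rewrite mem_Frho => /eqP ->; rewrite addr0.
  exists a => //; exists (point_at L s n - point_at L s n1 - a); last by rewrite addrC subrK.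
  by rewrite /= mem_Frho linearB /= un e subrr.
have := count_estimate K0 d_ge2 bound n1 uX X0.
set x := `|_| => hx; rewrite XE.
have -> : ncard (int_vectors R X) = size X.
  exact: (ncard_image_seq (@int_vector_inj R d) uX).
have ex j := exits_le j uX.
(* If the Hausdorff measure is infinite the bound is trivial, the constant being positive; the value
   [-oo] would contradict [exits_le]. *)
move: ex; set H := hausdorff _ _; case: H => [r|_|].
- move=> ex; rewrite -!EFinM lee_fin; apply: le_trans hx _.
  rewrite ler_wpM2r ?invr_ge0 // -/K -[leRHS]mulrA (ler_wpM2l (mulr_ge0 _ K0)) // natr_sum.
  apply: (@le_trans _ _ (\sum_(j < d) c * r)).
    by apply: ler_sum => j _; have := ex j; rewrite -EFinM lee_fin.
  by rewrite sumr_const card_ord -[leLHS]mulr_natl mulrA.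
- rewrite gt0_muley ?gt0_mulye ?leey // lte_fin.
    by rewrite invr_gt0 ltr0n.
  rewrite mulr_gt0 ?mulr_gt0 ?exprn_gt0 // ltr0n; exact: ltn_trans d_ge2.
- move=> /(_ (Ordinal (ltnW d_ge2))).
  by rewrite gt0_muleNy ?lte_fin // leeNy_eq.
Qed.

End FrequencyBound.

Lemma class_pattern (R : realType) d m (L : 'M[R]_(m, d)) F (P : patch_class R d m) S s n :
  admissible L F -> regular_point L F s -> is_patch_class L F s P ->
  patch_steps L F P = [set` S] ->
  has_class L F s P (cps_at L F s n) <->
  pattern [seq star L z | z <- S & `[< class_shape P (projE L F z) >]]
    [seq star L z | z <- S & ~~ `[< class_shape P (projE L F z) >]] (torus_at L s n).
Proof.
move=> adm reg [_ _ [y cy hy]] SE; have [n1 e] := (cpsP adm reg y).1 cy; subst y.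
rewrite (has_class_steps adm reg n hy) SE /pattern -all_predC !all_map.
split=> [h|/andP[/allP h1 /allP h2] z /= zS].
  apply/andP; split; apply/allP => z; rewrite mem_filter => /andP[zs zS] /=.
    by apply/(h z zS); exact/asboolP.
  by apply: contra zs => fz; apply/asboolP; apply/(h z zS).
split=> [fz|sh]; last by apply: h1; rewrite mem_filter zS andbT; apply/asboolP.
apply: contrapT => nsh.
have zin : z \in [seq z <- S | ~~ `[< class_shape P (projE L F z) >]].
  by rewrite mem_filter zS andbT; apply/asboolPn.
by have := h2 z zin; rewrite /= fz.
Qed.

Lemma class_pattern_typeII (R : realType) d m (L : 'M[R]_(m, d)) F (P : patch_class R d m) S s n :
  admissible L F -> regular_point L F s -> is_patch_class L F s P ->
  class_type P = TypeII -> patch_steps L F P = [set` S] ->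
  has_class L F s P (cps_at L F s n) <->
  pattern [seq star L z | z <- S & `[< class_shape P (projE L F z) >]] [::] (torus_at L s n).
Proof.
move=> adm reg [_ _ [y cy hy]] tyP SE; have [n1 e] := (cpsP adm reg y).1 cy; subst y.
rewrite (has_class_steps_typeII n adm reg tyP hy) SE /pattern andbT all_map.
split=> [h|/allP h z /= zS sh].
  by apply/allP => z; rewrite mem_filter => /andP[/asboolP sh zS] /=; exact: h.
by apply: h; rewrite mem_filter zS andbT; apply/asboolP.
Qed.

Theorem theorem5p7 (R : realType) (k d : nat) (hd : (2 <= d)%N)
    (hk : (d < k)%N) (eps : R) (heps : 0 < eps) :
  almost_all [set L : 'M[R]_(k - d, d) |
    totally_irrational L ->
    forall F : {vspace 'cV[R]_(d + (k - d))}, admissible L F ->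
      (forall P : patch_class R d (k - d),
         exists2 C : R, 0 < C & frequency_bound L F P C) /\
      (exists2 C : R, 0 < C &
         forall P : patch_class R d (k - d),
           class_type P = TypeII -> frequency_bound L F P C)].
Proof.
have d_gt0 : (0 < d)%N by apply: leq_trans hd.
have m_gt0 : (0 < k - d)%N by rewrite subn_gt0.
have [c c0 exits_le] := exits_le_hausdorff R hd.
apply: (metric_discrepancy m_gt0 d_gt0) => L [C0 C0_ge0 goodL] _ F adm.
(* Adding 1 makes the constant positive even when [C0 = 0]. *)
pose C := C0 + 1; have C_gt0 : 0 < C by rewrite ltr_wpDl.
have L_good i (t a b : 'I_(k - d) -> R) : (forall j, 0 <= a j) -> (forall j, b j <= 1) ->
    `|box_count L (2 ^ i) t a b - (2 ^ i)%:R ^+ d * box_volume a b| <= C * (3 / 2) ^+ i.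
  move=> a0 b1; apply: le_trans (goodL i t a b a0 b1) _.
  by rewrite ler_wpM2r ?exprn_ge0 ?divr_ge0 // lerDl.
have pos n : 0 < 8 * (2 ^+ n * C) * (d%:R * c) by rewrite !mulr_gt0 ?exprn_gt0 ?ltr0n.
(* Patch regions are bounded, so otherwise the bound holds vacuously. *)
have unbounded P (K : R) : ~ bounded_set (class_region P) -> frequency_bound L F P K.
  by move=> nb s _ [_ [_ b _ _] _].
split=> [P|].
  have [bP|nb] := pselect (bounded_set (class_region P)); last first.
    by exists 1 => //; exact: unbounded.
  have /finite_seqP[S SE] := finite_patch_steps adm bP.
  eexists; last first.
    apply: (frequency_bound_pattern hd C_gt0 L_good c0 exits_le adm) => s reg sP n.
    apply: class_pattern adm reg sP SE.
  exact: pos.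
(* Type II patterns have no negated condition, so the factor is [2^0] for every class. *)
exists (8 * (2 ^+ 0 * C) * (d%:R * c)) => [|P tyP]; first exact: pos.
have [bP|nb] := pselect (bounded_set (class_region P)); last exact: unbounded.
have /finite_seqP[S SE] := finite_patch_steps adm bP.
apply: (frequency_bound_pattern (zp := [seq star L z | z <- S & `[< class_shape P (projE L F z) >]])
  (zn := [::]) hd C_gt0 L_good c0 exits_le adm) => s reg sP n.
exact: class_pattern_typeII.
Qed.
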